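(* For every $\chi\in\mathfrak a^*$ and every $f\in C_c(W)$, $$\lim_{T\to\infty}\frac{1}{T^{a_\chi}(\log T)^{b_\chi-1}}\int_{\mathfrak a^+}f(\phi(a)/T)\,e^{\chi(a)}\,da=\kappa_\chi\,L_\chi(f)<\infty,$$ where $\kappa_\chi=\mathrm{Vol}\big(\mathfrak a^+\cap\ker I_\chi\cap\{\lambda_1=1\}\big)$.
   Context: Setting. - $\mathfrak a\cong\mathbb R^r$ is a real vector space and $W$ a finite-dimensional real vector space. - $w_1,\dots,w_k\in W$ are linearly independent, $\lambda_1,\dots,\lambda_k\in\mathfrak a^*$, and $\phi:\mathfrak a\to W$, $\phi(a)=\sum_{i=1}^k e^{\lambda_i(a)}w_i$. - $\Delta$ is a fixed basis of $\mathfrak a^*$, and $\mathfrak a^+=\{a:\alpha(a)\ge0\ \forall\alpha\in\Delta\}$. - Assume (1) $\lambda_1=\sum_{\alpha\in\Delta}m_\alpha\alpha$ with all $m_\alpha>0$, and (2) for every $i$, $\lambda_1-\lambda_i=\sum_{\alpha\in\Delta}m_{i,\alpha}\alpha$ with $m_{i,\alpha}\ge0$. Put $\operatorname{supp}\lambda_i=\{\alpha:m_{i,\alpha}>0\}$. Definitions attached to $\chi=\sum_{\alpha\in\Delta}v_\alpha(\chi)\alpha$. - $a_\chi=\max_{\alpha\in\Delta}v_\alpha(\chi)/m_\alpha$, $I_\chi=\{\alpha\in\Delta:v_\alpha(\chi)/m_\alpha<a_\chi\}$, and $b_\chi=\#(\Delta\setminus I_\chi)$. - $\ker I_\chi=\bigcap_{\alpha\in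 I_\chi}\ker\alpha$, and $\mathfrak d_0=\ker\chi\cap\ker I_\chi$ (which equals $\ker\lambda_i\cap\ker I_\chi$ whenever $\operatorname{supp}\lambda_i\subset I_\chi$). - $\mathfrak d^+=\{\bar a\in\mathfrak a/\mathfrak d_0:\alpha(a)\ge0\ \forall\alpha\in I_\chi\}$. - $\psi(\bar a)=\sum_{i:\operatorname{supp}\lambda_i\subset I_\chi}e^{\lambda_i(a)}w_i$ for $\bar a\in\mathfrak a/\mathfrak d_0$ (well defined). - $L_\chi(f)=\int_{\mathfrak d^+}f(\psi(\bar a))e^{\chi(a)}\,d\bar a$ (with $e^{\chi(a)}$ well defined on $\mathfrak a/\mathfrak d_0$). Measures: $da$ and $d\bar a$ are Lebesgue measures on $\mathfrak a$ and $\mathfrak a/\mathfrak d_0$, and $\mathrm{Vol}$ is the induced Lebesgue measure on the level set, all normalized compatibly.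
   Formalization: The formal theorem assumes a_χ > 0: for a_χ < 0 the claim fails (L_χ(f) = ∞ whenever f ≥ 0 and f(0) > 0), and for a_χ = 0 the map ψ is not well defined on 𝔞/𝔡_0. *)

(* Defs.v *)
From HB Require Import structures.
From mathcomp Require Import all_boot all_order all_algebra.
From mathcomp Require Import all_classical all_reals all_analysis.
Set Implicit Arguments. Unset Strict Implicit. Unset Printing Implicit Defensive.
Import Order.TTheory GRing.Theory Num.Theory.
Import numFieldNormedType.Exports.
Local Open Scope classical_set_scope.
Local Open Scope ring_scope.

(* Conventions:
   a = R^(r+1) with coordinates given by the basis Delta (alpha_j(a) = a j);
   an element of a^* is given by its coefficient vector on Delta:
   lambda(a) = \sum_j lambda_j * a j.
   W = 'rV[R]_n. *)

Section Defs.
Variable R : realType.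

Definition evf (r : nat) (c : 'I_r -> R) (x : 'I_r -> R) : R :=
  \sum_(j < r) c j * x j.

Definition upd (r : nat) (x : 'I_r -> R) (i : 'I_r) (t : R) : 'I_r -> R :=
  fun j => if j == i then t else x j.

(* Lebesgue integral over the coordinates listed in s (the other coordinates
   frozen at those of x), as an iterated integral of Lebesgue measure on R
   (Fubini). *)
Definition iint (r : nat) (s : seq 'I_r) (g : ('I_r -> R) -> \bar R) :
    ('I_r -> R) -> \bar R :=
  foldr (fun i G => fun x => (\int[@lebesgue_measure R]_(t in [set: R]) G (upd x i t))%E)
        g s.

Definition leb_int (r : nat) (g : ('I_r -> R) -> \bar R) : \bar R :=
  iint (enum 'I_r) g (fun _ => 0).

Definition lin_indep (n k : nat) (w : 'I_k -> 'rV[R]_n) : Prop :=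
  forall c : 'I_k -> R, \sum_(i < k) c i *: w i = 0 -> forall i, c i = 0.

Definition Cc (n : nat) (f : 'rV[R]_n -> R) : Prop :=
  continuous f /\ exists K : set 'rV[R]_n, compact K /\ forall w, ~ K w -> f w = 0.

Variables (r n k : nat).
(* lam i : coefficients of lambda_(i+1) on Delta ; lam ord0 = lambda_1 *)
Variables (w : 'I_k.+1 -> 'rV[R]_n) (lam : 'I_k.+1 -> 'I_r.+1 -> R).

Definition mcoef (j : 'I_r.+1) : R := lam ord0 j.
Definition mcoef_i (i : 'I_k.+1) (j : 'I_r.+1) : R := lam ord0 j - lam i j.

Definition phi (x : 'I_r.+1 -> R) : 'rV[R]_n :=
  \sum_(i < k.+1) expR (evf (lam i) x) *: w i.

Variable chi : 'I_r.+1 -> R.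

Definition a_chi : R := \big[Num.max/chi ord0 / mcoef ord0]_(j < r.+1) (chi j / mcoef j).
Definition I_chi : {set 'I_r.+1} := [set j | chi j / mcoef j < a_chi].
Definition b_chi : nat := #|~: I_chi|.

Definition lhs_integral (f : 'rV[R]_n -> R) (T : R) : \bar R :=
  leb_int (fun x => if [forall j, 0 <= x j]
                    then (f (T^-1 *: phi x) * expR (evf chi x))%:E else 0%E).

Definition supp_in_I (i : 'I_k.+1) : bool :=
  [forall j, (0 < mcoef_i i j) ==> (j \in I_chi)].

Definition psi (x : 'I_r.+1 -> R) : 'rV[R]_n :=
  \sum_(i < k.+1 | supp_in_I i) expR (evf (lam i) x) *: w i.

(* a distinguished element of Delta \ I_chi (nonempty) *)
Definition j0 : 'I_r.+1 := odflt ord0 [pick j in ~: I_chi].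

(* Coordinates on a/d_0 : abar |-> ((alpha(a))_(alpha in I_chi), lambda_1(a)),
   an isomorphism a/d_0 ~ R^I x R (d_0 = ker I_chi /\ ker lambda_1 = ker chi /\ ker I_chi
   when a_chi <> 0).  The point x (whose coordinates in I_chi and at j0 carry
   (y, u) ) is sent to the representative sec x of the class with those coordinates. *)
Definition sec (x : 'I_r.+1 -> R) : 'I_r.+1 -> R :=
  fun j => if j \in I_chi then x j
           else if j == j0 then
             (x j0 - \sum_(l in I_chi) mcoef l * x l) / mcoef j0
           else 0.

(* L_chi(f) = int_{d^+} f(psi(abar)) e^{chi(abar)} dabar, dabar = Lebesgue measure
   in the coordinates above *)
Definition L_chi (f : 'rV[R]_n -> R) : \bar R :=
  iint (enum (j0 |: I_chi))
    (fun x => if [forall j in I_chi, 0 <= x j]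
              then (f (psi (sec x)) * expR (evf chi (sec x)))%:E else 0%E)
    (fun _ => 0).

(* Lebesgue measure on ker I_chi ~ R^(Delta \ I_chi) of the slab
   a^+ /\ ker I_chi /\ {1 <= lambda_1 <= 1 + e} *)
Definition slab_vol (e : R) : \bar R :=
  iint (enum (~: I_chi))
    (fun z => if [forall j, 0 <= z j] && (1 <= evf (lam ord0) z <= 1 + e)
              then 1%E else 0%E)
    (fun _ => 0).

(* kappa_chi = Vol(a^+ /\ ker I_chi /\ {lambda_1 = 1}), the induced measure on
   the level set normalised by d(lambda_1) (coarea normalisation) *)
Definition kappa_chi : \bar R :=
  lim ((fun e => ((e^-1)%:E * slab_vol e)%E) @ 0^'+).

End Defs.

(* Main.v *)
Require Import Defs.
From HB Require Import structures.
From mathcomp Require Import all_boot all_order all_algebra.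
From mathcomp Require Import all_classical all_reals all_analysis.
From mathcomp Require Import measurable_realfun ring lra.
Set Implicit Arguments. Unset Strict Implicit. Unset Printing Implicit Defensive.
Import Order.TTheory GRing.Theory Num.Theory.
Import numFieldNormedType.Exports.
Local Open Scope classical_set_scope.
Local Open Scope ring_scope.

(* Put tau = log T and write chi = a lambda_1 - sum_(I) c_j alpha_j with c_j > 0.
   Choose coordinates x = (y, u, s): y in R^I are the coordinates in I, the
   coordinates in J = Delta \ (I + {j0}) are tau s, and u = lambda_1 - tau.  The
   Jacobian is tau^(b-1) / m_(j0), and e^chi = T^a e^(a u - c.y).  As tau goes to
   infinity the integrand tends, off the null set where some s_j = 0 or
   lambda_1(s) = 1, to the product of the integrand of L_chi(f) in (y, u) and of
   the indicator of the simplex {s >= 0, lambda_1(s) <= 1}.  Since the w_i are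
   independent and f has compact support, u is bounded above on the support, which
   gives an integrable majorant.  The volume of the simplex over m_(j0) is kappa_chi,
   by the same substitution applied to the slab.  Signed f are split as f^+ - f^-. *)

(** * Iterated integrals *)

(** [leb_int] is by definition an iterated integral, not an integral against a product measure.
    Tonelli, the affine substitutions, dominated convergence and the exceptional null set are
    therefore all carried through one coordinate at a time, and each majorant is a product of
    one-variable functions, so that all its partial integrals are finite at every point.

    Source of the limit: the coefficient of w_i in phi / T is exp (u - \sum_j m_(i,j) alpha_j). Off
    I the alpha_j grow linearly in tau, so this coefficient dies unless supp lambda_i lies in I, and
    psi remains. The constraint alpha_(j0) >= 0, divided by tau, becomes lambda_1(s) <= 1 + O(1 /
    tau), whence the simplex. The upper bound on u is read off the coefficient e^u of w_1; for u
    near -oo, integrability of the majorant e^(a u) rests on a > 0. *)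

Definition coord_sets (R : realType) (r : nat) : set (set ('I_r -> R)) :=
  [set A | exists (i : 'I_r) (B : set R), measurable B /\ A = (fun x => x i) @^-1` B].

(** An alias of the function type that carries the sigma-algebra generated by the coordinates. *)
Definition rfun (R : realType) (r : nat) : Type := 'I_r -> R.
HB.instance Definition _ R r := Measurable.copy (rfun R r) (g_sigma_algebraType (@coord_sets R r)).

Section IteratedIntegral.
Context {R : realType} {r : nat}.
Local Notation mu := (@lebesgue_measure R).
Local Notation V := (rfun R r).

Lemma measurable_coord (i : 'I_r) : measurable_fun [set: V] (fun x : V => x i).
Proof.
by move=> _ B mB; rewrite setTI; apply: sub_gen_smallest; exists i, B.
Qed.

Lemma measurable_fun_coords d (T : measurableType d) (F : T -> V) :
  (forall j, measurable_fun [set: T] (fun t => F t j)) -> measurable_fun [set: T] F.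
Proof.
move=> mF; apply: (@measurability _ _ T V setT F (@coord_sets R r)) => //.
move=> _ [_ [i [B [mB ->]]] <-]; exact: (mF i measurableT B mB).
Qed.

Lemma measurable_upd (i : 'I_r) :
  measurable_fun [set: V * R] (fun p : V * R => upd p.1 i p.2 : V).
Proof.
apply: measurable_fun_coords => j; rewrite /upd; case: (j == i) => /=.
  exact: measurable_snd.
exact: measurableT_comp (measurable_coord j) measurable_fst.
Qed.

Lemma measurable_upd_snd (x : V) (i : 'I_r) :
  measurable_fun [set: R] (fun t : R => upd x i t : V).
Proof.
apply: measurable_fun_coords => j; rewrite /upd.
by case: (j == i) => //=; exact: measurable_id.
Qed.

Definition mge0 (g : V -> \bar R) := measurable_fun [set: V] g /\ forall x, (0 <= g x)%E.

Lemma mge0_upd (g : V -> \bar R) (x : V) i : mge0 g ->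
  measurable_fun [set: R] (fun t => g (upd x i t)).
Proof. by move=> [mg _]; exact: measurableT_comp mg (measurable_upd_snd x i). Qed.

Lemma mge0_int (g : V -> \bar R) i : mge0 g ->
  mge0 (fun x => \int[mu]_(t in [set: R]) g (upd x i t))%E.
Proof.
move=> [mg g0]; split; last by move=> x; exact: integral_ge0.
apply: (@measurable_fun_fubini_tonelli_F _ _ V (measurableTypeR R) R mu
  (fun p => g (upd p.1 i p.2))) => //.
exact: measurableT_comp mg (measurable_upd i).
Qed.

Lemma mge0_iint (g : V -> \bar R) s : mge0 g -> mge0 (iint s g : V -> \bar R).
Proof. by move=> mg; elim: s => //= i s; exact: mge0_int. Qed.

Lemma iint_cat (s1 s2 : seq 'I_r) (g : V -> \bar R) :
  iint (s1 ++ s2) g = iint s1 (iint s2 g).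
Proof. by rewrite /iint foldr_cat. Qed.

Lemma upd_upd (x : V) (i j : 'I_r) (t u : R) : i != j ->
  upd (upd x i t) j u = upd (upd x j u) i t.
Proof.
move=> ij; apply/funext => l; rewrite /upd.
by case: (eqVneq l j) => // ->; rewrite eq_sym (negbTE ij).
Qed.

Lemma iint_swap (i j : 'I_r) (g : V -> \bar R) : mge0 g ->
  iint [:: i; j] g = iint [:: j; i] g.
Proof.
move=> [mg g0]; case: (eqVneq i j) => [-> //|ij]; apply/funext => x /=.
under [RHS]eq_integral do under eq_integral do rewrite -upd_upd//.
apply: (@fubini_tonelli _ _ (measurableTypeR R) (measurableTypeR R) R mu mu
  (fun p => g (upd (upd x i p.1) j p.2))) => //.
apply: measurableT_comp mg _.
apply: (@measurableT_comp _ _ _ _ _ _ _ _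
  (fun p : R * R => ((upd x i p.1 : V), p.2)) (measurable_upd j)).
apply: measurable_fun_pair => //=.
exact: measurableT_comp (measurable_upd_snd x i) measurable_fst.
Qed.

Lemma iint_perm (s1 s2 : seq 'I_r) (g : V -> \bar R) : mge0 g ->
  perm_eq s1 s2 -> iint s1 g = iint s2 g.
Proof.
move=> mg.
(* Adjacent swaps bring any entry to the front; [iint_swap] is an equality of functions, so it
   applies to whatever inner iterated integral follows. *)
have mid i p1 p2 : iint (p1 ++ i :: p2) g = iint (i :: p1 ++ p2) g.
  elim: p1 => //= j p1 IH.
  transitivity (iint [:: j; i] (iint (p1 ++ p2) g)); first by rewrite /= IH.
  by rewrite iint_swap//; exact: mge0_iint.
elim: s1 s2 => [|i s1 IH] s2 ps.
  by move: ps; rewrite perm_sym => /perm_nilP ->.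
have : i \in s2 by rewrite -(perm_mem ps) mem_head.
move=> /path.splitPr is2; case: is2 ps => p1 p2.
rewrite perm_sym (perm_catCA p1 [:: i] p2) /= perm_cons perm_sym => /IH e.
by rewrite mid /= e.
Qed.

Lemma iint_dep (D : pred 'I_r) (g : V -> \bar R) s :
  (forall x y : V, (forall j, D j -> x j = y j) -> g x = g y) ->
  forall x y : V, (forall j, D j -> j \notin s -> x j = y j) ->
  iint s g x = iint s g y.
Proof.
move=> hg; elim: s => [|i s IH] x y hxy /=; first by apply: hg => j /hxy; exact.
apply: eq_integral => t _; apply: IH => j Dj js; rewrite /upd.
by case: (eqVneq j i) => // ji; apply: hxy => //; rewrite inE negb_or ji.
Qed.

Lemma le_iint (g1 g2 : V -> \bar R) s x : mge0 g1 -> mge0 g2 ->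
  (forall x, g1 x <= g2 x)%E -> (iint s g1 x <= iint s g2 x)%E.
Proof.
move=> m1 m2 le12; elim: s x => //= i s IH x.
have n1 := mge0_iint s m1; have n2 := mge0_iint s m2.
apply: ge0_le_integral => //=.
- by move=> t _; exact: n1.2.
- exact: mge0_upd.
- exact: mge0_upd.
Qed.

Lemma iintM (c : V -> R) (g : V -> \bar R) s x : mge0 g -> (forall x, 0 <= c x) ->
  (forall i y t, i \in s -> c (upd y i t) = c y) ->
  iint s (fun y => (c y)%:E * g y)%E x = ((c x)%:E * iint s g x)%E.
Proof.
move=> mg c0; elim: s x => [|i s IH] x hc //=.
have n := mge0_iint s mg.
under eq_integral.
  move=> t _; rewrite IH; last by move=> j y u js; apply: hc; rewrite inE js orbT.
  rewrite hc ?mem_head//; over.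
rewrite ge0_integralZl_EFin//; first by move=> t _; exact: n.2.
exact: mge0_upd.
Qed.

(* Finiteness at every x, and for every subset of the coordinates of s: the
   library integral of a non-integrable signed function is a junk value, so each
   intermediate stage of an iterated integral has to be controlled. *)
Definition iint_fin (s : seq 'I_r) (h : V -> \bar R) :=
  forall s' x, uniq s' -> {subset s' <= s} -> (iint s' h x < +oo)%E.

Lemma iint_fin_le s (g h : V -> \bar R) : mge0 g -> mge0 h -> (forall x, g x <= h x)%E ->
  iint_fin s h -> iint_fin s g.
Proof.
move=> mg mh gh fh s' x us ss; apply: le_lt_trans (fh s' x us ss).
exact: le_iint.
Qed.

Lemma iint_fin_integrable s i s' (h : V -> \bar R) x : mge0 h -> iint_fin s h ->
  uniq (i :: s') -> {subset i :: s' <= s} ->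
  mu.-integrable [set: R] (fun t => iint s' h (upd x i t)).
Proof.
move=> mh fh us ss; have n := mge0_iint s' mh.
apply/integrableP; split; first exact: mge0_upd.
under eq_integral do rewrite gee0_abs ?n.2//.
exact: (fh (i :: s') x us ss).
Qed.

Lemma iintB s (g1 g2 : V -> \bar R) x : mge0 g1 -> mge0 g2 ->
  iint_fin s g1 -> iint_fin s g2 -> uniq s ->
  iint s (fun y => g1 y - g2 y)%E x = (iint s g1 x - iint s g2 x)%E.
Proof.
move=> m1 m2 f1 f2 us.
suff H s' y : uniq s' -> {subset s' <= s} ->
    iint s' (fun y => g1 y - g2 y)%E y = (iint s' g1 y - iint s' g2 y)%E.
  exact: H.
elim: s' y => //= i s' IH y /andP[is' us'] ss.
rewrite -integralB//.
- apply: eq_integral => t _; rewrite IH// => j js; apply: ss; rewrite inE js orbT//.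
- by apply: (iint_fin_integrable (s := s)) => //=; rewrite is'.
- by apply: (iint_fin_integrable (s := s)) => //=; rewrite is'.
Qed.

(** The source of all majorants below. Integrating over part of the coordinates replaces those
    factors by their integrals and leaves the others frozen, so every partial integral is an
    explicit real number. *)
Lemma iint_prod_fin (s : seq 'I_r) (C : R) (h : 'I_r -> R -> R) :
  0 <= C -> (forall j t, 0 <= h j t) ->
  (forall j, measurable_fun [set: R] (h j)) ->
  (forall j, j \in s -> (\int[mu]_t (h j t)%:E < +oo)%E) ->
  mge0 (fun x => (C * \prod_j h j (x j))%:E) /\
  iint_fin s (fun x => (C * \prod_j h j (x j))%:E).
Proof.
move=> C0 h0 mh fh; split.
  split.
    apply/measurable_EFinP; apply: measurable_funM => //.
    apply: measurable_prod => j _.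
    exact: measurableT_comp (mh j) (measurable_coord j).
  by move=> x; rewrite lee_fin mulr_ge0// prodr_ge0.
pose c j := fine (\int[mu]_t (h j t)%:E).
have cE j : j \in s -> (\int[mu]_t (h j t)%:E)%E = (c j)%:E.
  move=> js; rewrite /c fineK// ge0_fin_numE ?fh//.
  by apply: integral_ge0 => t _; rewrite lee_fin.
have c0 j : 0 <= c j.
  by rewrite fine_ge0//; apply: integral_ge0 => t _; rewrite lee_fin.
move=> s' x us' ss.
suff -> : iint s' (fun x => (C * \prod_j h j (x j))%:E) x =
    (C * \prod_j (if j \in s' then c j else h j (x j)))%:E by rewrite ltry.
elim: s' x us' ss => [|i s' IH] x //= /andP[is' us'] ss.
under eq_integral.
  move=> t _; rewrite IH//; last by move=> j js; apply: ss; rewrite inE js orbT.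
  rewrite (bigD1 i)//= (negbTE is') {1}/upd eqxx mulrCA.
  rewrite (eq_bigr (fun j => if j \in i :: s' then c j else h j (x j))); last first.
    by move=> j ji; rewrite inE (negbTE ji) /upd (negbTE ji).
  rewrite mulrC EFinM; over.
rewrite ge0_integralZl_EFin//; last 3 first.
- by move=> t _; rewrite lee_fin.
- by apply/measurable_EFinP; exact: mh.
- by rewrite mulr_ge0// prodr_ge0// => j _; case: ifP.
rewrite cE ?ss ?mem_head//= -EFinM; congr EFin.
by rewrite [in RHS](bigD1 i)//= mem_head -mulrA [_ * c i]mulrC.
Qed.

(** The iterated form of almost everywhere, in which the exceptional set of each coordinate may
    depend on the outer ones: what dominated convergence consumes when it is applied one integral at
    a time. *)
Definition ae_iint (s : seq 'I_r) (P : V -> Prop) : V -> Prop :=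
  foldr (fun i (Q : V -> Prop) (x : V) => {ae mu, forall t, Q (upd x i t)}) P s.

#[global] Instance ae_lebesgue_filter : Filter (almost_everywhere mu).
Proof. exact: (@ae_filter_ringOfSetsType _ (measurableTypeR R) R mu). Qed.

Lemma ae_iintT s P x : (forall x, P x) -> ae_iint s P x.
Proof.
by move=> HP; elim: s x => //= i s IH x; exact: aeW.
Qed.

Lemma ae_iint_cat s1 s2 P x : ae_iint (s1 ++ s2) P x = ae_iint s1 (ae_iint s2 P) x.
Proof. by rewrite /ae_iint foldr_cat. Qed.

Lemma ae_iintI s P Q x : ae_iint s P x -> ae_iint s Q x ->
  ae_iint s (fun y => P y /\ Q y) x.
Proof.
elim: s x => //= i s IH x aP aQ.
by apply: (filterS2 (F := almost_everywhere mu)) aP aQ => t; exact: IH.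
Qed.

Lemma ae_iint_impl s (P Q : V -> Prop) x : (forall y, P y -> Q y) ->
  ae_iint s P x -> ae_iint s Q x.
Proof.
move=> PQ; elim: s x => /= [x|i s IH x aP]; first exact: PQ.
by apply: (filterS (F := almost_everywhere mu)) aP => t; exact: IH.
Qed.

Lemma ae_iint_coord s i (P : R -> Prop) (x : V) : i \in s -> uniq s ->
  {ae mu, forall t, P t} -> ae_iint s (fun y => P (y i)) x.
Proof.
move=> + + aP; elim: s x => //= j s IH x; rewrite inE => /orP[/eqP <-|is1] /andP[js us].
  apply: (filterS (F := almost_everywhere mu)) aP => t Pt.
  suff H s' (y : V) : i \notin s' -> P (y i) -> ae_iint s' (fun y => P (y i)) y.
    by apply: H => //; rewrite /upd eqxx.
  elim: s' y => //= l s' IH' y; rewrite inE negb_or => /andP[il is'] Py.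
  by apply: aeW => u; apply: IH' => //; rewrite /upd (negbTE il).
by apply: aeW => t; exact: IH.
Qed.

(** One application of dominated convergence per coordinate: at each stage the majorant is the
    partial integral of [h] over the inner coordinates, integrable by [iint_fin]. *)
Lemma iint_dct s (P : V -> Prop) (g_ : nat -> V -> \bar R) (g h : V -> \bar R) x :
  uniq s -> (forall n, mge0 (g_ n)) -> mge0 g -> mge0 h ->
  (forall n y, g_ n y <= h y)%E -> iint_fin s h ->
  ae_iint s P x ->
  (forall y, P y -> g_ n y @[n --> \oo] --> g y) ->
  iint s (g_ n) x @[n --> \oo] --> iint s g x.
Proof.
move=> us mg_ mg mh gh fh + cg.
suff H s' y : uniq s' -> {subset s' <= s} -> ae_iint s' P y ->
    iint s' (g_ n) y @[n --> \oo] --> iint s' g y by exact: H.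
elim: s' y => /= [y _ _|i s' IH y /andP[is' us'] ss aP]; first exact: cg.
have [|||||_ _] := @dominated_convergence _ _ R mu setT measurableT
  (fun n t => iint s' (g_ n) (upd y i t)) (fun t => iint s' g (upd y i t))
  (fun t => iint s' h (upd y i t)); last exact.
- by move=> n; apply: mge0_upd; exact: mge0_iint.
- by apply: mge0_upd; exact: mge0_iint.
- apply: (filterS (F := almost_everywhere mu)) aP => t aPt _; apply: IH => // j js; apply: ss.
  by rewrite inE js orbT.
- by apply: (iint_fin_integrable (s := s)) => //=; rewrite is'.
- apply: aeW => t n _; rewrite gee0_abs; first exact: le_iint.
  exact: (mge0_iint s' (mg_ n)).2.
Qed.

(** Half-open intervals determine Lebesgue measure, so on these alone it is compared with [c] times
    its image under the affine map. *)
Lemma integral_affine (g : R -> \bar R) (c b : R) : 0 < c ->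
  measurable_fun [set: R] g -> (forall t, 0 <= g t)%E ->
  (\int[mu]_t g t = c%:E * \int[mu]_t g (c * t + b)%R)%E.
Proof.
move=> c0 mg g0.
pose F : R -> R := fun t => c * t + b.
have mF : @measurable_fun _ _ (measurableTypeR R) (measurableTypeR R) setT F.
  by apply: measurable_funD => //; exact: measurable_funM.
pose mFm := isMeasurableFun.Build _ _ (measurableTypeR R) (measurableTypeR R) F mF.
pose F' : {mfun measurableTypeR R >-> measurableTypeR R} := HB.pack F mFm.
have cge0 : 0 <= c by exact: ltW.
pose c' := NngNum cge0.
have E A : measurable A -> mu A = mscale c' (pushforward mu F') A.
  apply: lebesgue_measure_unique => _ [[a d]] _ <-.
  rewrite /= /mscale/= /pushforward.
  have -> : F' @^-1` `]a, d] = `](a - b) / c, (d - b) / c]%classic.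
    apply/seteqP; split => t; rewrite /F /= !in_itv/= ltr_pdivrMr// ler_pdivlMr//;
    by rewrite ltrBlDr lerBrDr [t * c]mulrC.
  rewrite !lebesgue_measure_itv/= !lte_fin ltr_pM2r ?invr_gt0// ltrD2r.
  case: ifP => _; last by rewrite mule0.
  rewrite -!EFinB -EFinM; congr EFin.
  by rewrite -mulrBl opprB addrA subrK mulrCA divff ?gt_eqF// mulr1.
rewrite (@eq_measure_integral _ _ _ setT (mscale c' (pushforward mu F'))); last first.
  by move=> A mA _; exact: E.
rewrite ge0_integral_mscale//=; congr (_ * _)%E.
by rewrite ge0_integral_pushforward//.
Qed.

(** The shift [B] may depend on the other coordinates. With [i] moved to the innermost position
    these are frozen, [B] is a constant, and the one-dimensional substitution applies. *)
Lemma iint_affine s (i : 'I_r) (c : R) (B : V -> R) (g : V -> \bar R) (x : V) :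
  uniq s -> i \in s -> 0 < c -> measurable_fun [set: V] B ->
  (forall y t, B (upd y i t) = B y) -> mge0 g ->
  iint s g x = (c%:E * iint s (fun y => g (upd y i (c * y i + B y))) x)%E.
Proof.
move=> us is' c0 mB hB mg.
pose g' (y : V) := g (upd y i (c * y i + B y)).
have mg' : mge0 g'.
  split; last by move=> y; exact: mg.2.
  apply: measurableT_comp mg.1 _.
  apply: (@measurableT_comp _ _ _ _ _ _ _ _
    (fun y : V => (y, c * y i + B y)) (measurable_upd i)).
  apply: measurable_fun_pair => //; apply: measurable_funD => //.
  by apply: measurable_funM => //; exact: measurable_coord.
have ps : perm_eq s (rcons (rem i s) i) by rewrite perm_sym perm_rcons perm_sym perm_to_rem.
rewrite (iint_perm mg ps) (iint_perm mg' ps) -cats1 !iint_cat.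
rewrite -(iintM (c := fun=> c))//; [|exact: mge0_iint|by move=> _; exact: ltW].
congr (iint _ _ x); apply/funext => y /=.
rewrite (@integral_affine (fun t => g (upd y i t)) c (B y))//.
- congr (_ * _)%E; apply: eq_integral => t _; rewrite /g' hB.
  by congr g; apply/funext => j; rewrite /upd; case: eqP => // _; rewrite eqxx.
- exact: mge0_upd.
- by move=> t; exact: mg.2.
Qed.

End IteratedIntegral.

(** * Limits at +oo and at 0+ reduced to sequences, the form that dominated convergence handles *)

Lemma cvg_pinfty_seq (R : realType) (X : topologicalType) (f : R -> X) (l : X) (a : R) :
  (forall u : nat -> R, (forall n, a <= u n) -> u n @[n --> \oo] --> +oo ->
    f (u n) @[n --> \oo] --> l) ->
  f x @[x --> +oo] --> l.
Proof.
move=> H A Al; apply: contrapT => nA.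
have ex n : exists x : R, Num.max a n%:R <= x /\ ~ A (f x).
  apply: contrapT => /forallNP hx; apply: nA.
  exists (Num.max a n%:R); split; first exact: num_real.
  by move=> x ltx; apply: contrapT => nAx; apply: (hx x); split => //; exact: ltW.
have [u hu] := choice ex.
have ua n : a <= u n by have [] := hu n; rewrite ge_max => /andP[].
have uoo : u n @[n --> \oo] --> +oo.
  apply/cvgryPge => M; near=> n; have [+ _] := hu n.
  rewrite ge_max => /andP[_]; apply: le_trans.
  near: n; exact: nbhs_infty_ger.
have [N _ /(_ N (leqnn N))] := H u ua uoo A Al.
by have [] := hu N.
Unshelve. all: by end_near. Qed.

Lemma cvg_at_right0_seq (R : realType) (X : topologicalType) (f : R -> X) (l : X) :
  (forall u : nat -> R, (forall n, 0 < u n <= 1) -> u n @[n --> \oo] --> (0 : R) ->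
    f (u n) @[n --> \oo] --> l) ->
  f x @[x --> 0^'+] --> l.
Proof.
move=> H A Al; apply: contrapT => nA.
have ex n : exists x : R, 0 < x <= n.+1%:R^-1 /\ ~ A (f x).
  apply: contrapT => /forallNP hx; apply: nA.
  suff : \forall x \near (0 : R)^'+, A (f x) by [].
  near=> x; apply: contrapT => nAx; apply: (hx x); split => //; apply/andP; split.
    by near: x; exact: nbhs_right_gt.
  by near: x; apply: nbhs_right_le; rewrite invr_gt0.
have [u hu] := choice ex.
have u1 n : 0 < u n <= 1.
  have [/andP[-> /le_trans] /= + _] := hu n; apply.
  by rewrite invf_le1// ler1n.
have u0 : u n @[n --> \oo] --> (0 : R).
  apply: (@squeeze_cvgr _ _ _ _ (fun=> 0) (fun n => n.+1%:R^-1)).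
  - by near=> n; have [/andP[/ltW-> ->]] := hu n.
  - exact: cvg_cst.
  - exact: cvg_harmonic.
have [N _ /(_ N (leqnn N))] := H u u1 u0 A Al.
by have [] := hu N.
Unshelve. all: by end_near. Qed.

(** * Measurability, one-variable integrals and dilations *)

Section Extra.
Context {R : realType} {r : nat}.
Local Notation mu := (@lebesgue_measure R).
Local Notation V := (rfun R r).

(* A sequentially continuous F is the pointwise limit of its values on the
   lattice of mesh 1/(n+1), and these approximations factor through a
   countable set. *)
Lemma measurable_seq_continuous (F : V -> R) :
  (forall (u : nat -> V) (x : V), (forall j, u n j @[n --> \oo] --> x j) ->
    F (u n) @[n --> \oo] --> F x) ->
  measurable_fun [set: V] F.
Proof.
move=> cF.
pose q n (x : V) : {ffun 'I_r -> int} := [ffun j => Num.floor (n.+1%:R * x j)].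
pose d n (z : {ffun 'I_r -> int}) : V := fun j => (z j)%:~R / n.+1%:R.
apply: (measurable_fun_cvg (h := fun n x => F (d n (q n x)))); last first.
  move=> x _; apply: cF => j.
  apply: (@squeeze_cvgr _ _ _ _ (fun n => x j - n.+1%:R^-1) (fun=> x j)).
  - near=> n; rewrite /d ffunE.
    have n0 : 0 < n.+1%:R :> R by [].
    rewrite ler_pdivrMr// ler_pdivlMr// mulrBl mulVf ?gt_eqF// mulrC.
    rewrite floor_le andbT lerBlDr.
    by have := floorD1_gt (n.+1%:R * x j); rewrite intrD => /ltW.
  - rewrite -[X in _ --> X]subr0; apply: cvgB; [exact: cvg_cst|exact: cvg_harmonic].
  - exact: cvg_cst.
move=> n _ B mB; rewrite setTI.
rewrite (_ : _ @^-1` B = \bigcup_(z in [set z | B (F (d n z))]) (q n @^-1` [set z])); last first.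
  apply/seteqP; split => [x Bx|x [z Bz /= xz]]; last first.
    by rewrite /= xz.
  by exists (q n x).
rewrite bigcup_mkcond; apply: countable_bigcupT_measurable => // z.
case: ifP => // _.
rewrite (_ : _ @^-1` _ = ~` \bigcup_(j in [set: 'I_r]) ~` ((fun x : V => x j) @^-1`
    ((fun t => Num.floor (n.+1%:R * t)) @^-1` [set z j]))); last first.
  rewrite setC_bigcup; apply/seteqP; split => [x /= xz j _|x /= xz].
    by rewrite setCK /= -xz ffunE.
  by apply/ffunP => j; rewrite ffunE; have := xz j Logic.I; rewrite setCK.
apply: measurableC; apply: countable_bigcupT_measurable => // j.
apply: measurableC; rewrite -[X in measurable X]setTI.
apply: measurable_coord => //.
rewrite (_ : _ @^-1` _ = `[(z j)%:~R / n.+1%:R, (z j + 1)%:~R / n.+1%:R[%classic)//.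
apply/seteqP; split => t /=; rewrite in_itv/= ler_pdivrMr// ltr_pdivlMr// [t * _]mulrC.
  by move=> <-; rewrite floor_le floorD1_gt.
by move=> h; apply: floor_def.
Unshelve. all: by end_near. Qed.

Lemma integral_opp (g : R -> \bar R) : measurable_fun [set: R] g -> (forall t, 0 <= g t)%E ->
  (\int[mu]_t g t = \int[mu]_t g (- t)%R)%E.
Proof.
move=> mg g0.
rewrite (@eq_measure_integral _ _ _ setT
  (pushforward mu (-%R : _ -> measurableTypeR R))); last first.
  by move=> A mA _; exact/esym/lebesgue_measureN.
by rewrite ge0_integral_pushforward.
Qed.

(** The factors of the majorants: [expneg_half] for the coordinates in I, [exppos_half] for u,
    [indic_seg] for coordinates confined to a segment. *)
Definition expneg_half (c : R) (t : R) : R := if 0 <= t then expR (- (c * t)) else 0.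
Definition exppos_half (c U : R) (t : R) : R := if t <= U then expR (c * t) else 0.
Definition indic_seg (C : R) (t : R) : R := if 0 <= t <= C then 1 else 0.

Lemma measurable_expneg_half c : measurable_fun [set: R] (expneg_half c).
Proof.
apply: measurable_fun_ifT => //; first exact: measurable_fun_ler.
apply: measurableT_comp => //; apply: measurableT_comp => //.
Qed.

Lemma measurable_exppos_half c U : measurable_fun [set: R] (exppos_half c U).
Proof.
apply: measurable_fun_ifT => //; first exact: measurable_fun_ler.
by apply: measurableT_comp => //.
Qed.

Lemma measurable_indic_seg C : measurable_fun [set: R] (indic_seg C).
Proof.
apply: measurable_fun_ifT => //.
by apply: measurable_and => //; exact: measurable_fun_ler.
Qed.

Lemma integral_expneg_half c : 0 < c -> (\int[mu]_t (expneg_half c t)%:E < +oo)%E.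
Proof.
move=> c0.
rewrite (_ : (fun t => _) = (fun t => (c^-1)%:E * (exponential_pdf c t)%:E)%E); last first.
  apply/funext => t; rewrite -EFinM; congr EFin.
  rewrite /expneg_half; case: ifPn => t0; last first.
    by rewrite lt0_exponential_pdf ?mulr0// ltNge.
  by rewrite exponential_pdfE// mulrA mulVf ?gt_eqF// mul1r mulNr.
rewrite ge0_integralZl_EFin//.
- by rewrite integral_exponential_pdf// mule1 ltry.
- by move=> t _; rewrite lee_fin exponential_pdf_ge0// ltW.
- by apply/measurable_EFinP; exact: measurable_exponential_pdf.
- by rewrite invr_ge0 ltW.
Qed.

Lemma integral_exppos_half c U : 0 < c -> (\int[mu]_t (exppos_half c U t)%:E < +oo)%E.
Proof.
move=> c0.
have e0 t : (0 <= (exppos_half c U t)%:E)%E.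
  by rewrite lee_fin /exppos_half; case: ifP => // _; exact: expR_ge0.
have me : measurable_fun [set: R] (fun t => (exppos_half c U t)%:E).
  by apply/measurable_EFinP; exact: measurable_exppos_half.
rewrite integral_opp// (@integral_affine _ _ 1 (- U))//; last first.
  by apply: measurableT_comp me _; exact: oppr_measurable.
rewrite mul1e.
rewrite (_ : (fun t => _) = (fun t => (expR (c * U))%:E * (expneg_half c t)%:E)%E); last first.
  apply/funext => t; rewrite -EFinM; congr EFin.
  rewrite /exppos_half /expneg_half mul1r opprB gerBl.
  case: ifP => _; last by rewrite mulr0.
  by rewrite -expRD; congr expR; ring.
rewrite ge0_integralZl_EFin//.
- apply: lte_mul_pinfty; rewrite ?lee_fin ?expR_ge0//.
  exact: integral_expneg_half.
- by move=> t _; rewrite lee_fin /expneg_half; case: ifP => // _; exact: expR_ge0.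
- by apply/measurable_EFinP; exact: measurable_expneg_half.
Qed.

Lemma integral_indic_seg C : 0 <= C -> (\int[mu]_t (indic_seg C t)%:E)%E = C%:E.
Proof.
move=> C0.
rewrite (_ : (fun t => _) = (fun t => (\1_(`[0, C]%classic) t)%:E)); last first.
  apply/funext => t; congr EFin; rewrite /indic_seg indicE.
  by case: ifPn => h; [rewrite mem_set|rewrite memNset]; rewrite //= in_itv//=; exact/negP.
rewrite integral_indic// setIT.
transitivity (mu `[0%R, C]%classic); first by [].
rewrite lebesgue_measure_itv/= lte_fin.
case: ltgtP C0 => // [C0 _|<- _]; last by [].
by rewrite oppr0 adde0.
Qed.

Definition scale_coords (c : R) (s : seq 'I_r) (x : V) : V :=
  fun j => if j \in s then c * x j else x j.

Lemma measurable_scale_coords c s : measurable_fun [set: V] (scale_coords c s : V -> V).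
Proof.
apply: measurable_fun_coords => j; rewrite /scale_coords; case: (j \in s).
  by apply: measurable_funM => //; exact: measurable_coord.
exact: measurable_coord.
Qed.

Lemma mge0_comp (g : V -> \bar R) (F : V -> V) : mge0 g -> measurable_fun [set: V] F ->
  mge0 (g \o F).
Proof.
by move=> [mg g0] mF; split; [exact: measurableT_comp|move=> x; exact: g0].
Qed.

Lemma iint_scale s s' c (g : V -> \bar R) x : uniq s -> uniq s' -> {subset s' <= s} ->
  0 < c -> mge0 g ->
  iint s g x = ((c ^+ size s')%:E * iint s (g \o scale_coords c s') x)%E.
Proof.
move=> us + + c0; elim: s' g => [|i s' IH] g /=.
  by move=> _ _ mg; rewrite expr0 mul1e.
move=> /andP[is' us'] ss mg.
rewrite (IH g)//; last by move=> j js; apply: ss; rewrite inE js orbT.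
rewrite (@iint_affine _ _ s i c (fun=> 0))//.
- rewrite muleA -EFinM -exprSr; congr (_ * iint _ _ x)%E; apply/funext => y /=.
  congr (g _); apply/funext => j; rewrite /scale_coords inE /upd addr0.
  by case: (eqVneq j i) => [->|]; rewrite ?(negbTE is') ?eqxx.
- by apply: ss; rewrite mem_head.
- by apply: mge0_comp => //; exact: measurable_scale_coords.
Qed.

(** Coordinates outside [s] keep the values of the base point throughout; for the slab this means
    that those in I stay equal to 0. *)
Lemma eq_iint_frozen s (g g' : V -> \bar R) x :
  (forall y : V, (forall j, j \notin s -> y j = x j) -> g y = g' y) ->
  iint s g x = iint s g' x.
Proof.
elim: s x => [|i s IH] x h /=; first exact: h.
apply: eq_integral => t _; apply: IH => y hy; apply: h => j.
by rewrite inE negb_or => /andP[ji js]; rewrite hy// /upd (negbTE ji).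
Qed.

End Extra.

(** * Compactly supported functions of linear combinations *)

Lemma cvg_sumr (K : numFieldType) (W : normedModType K) (T I : Type) (F : set_system T)
    (s : seq I) (P : pred I) (h : I -> T -> W) (l : I -> W) : Filter F ->
  (forall i, P i -> h i x @[x --> F] --> l i) ->
  \sum_(i <- s | P i) h i x @[x --> F] --> \sum_(i <- s | P i) l i.
Proof.
move=> FF; apply: cvg_big; exact: (@add_continuous W).
Qed.

Section CompactSupport.
Context {R : realType} {n k : nat}.

(** By independence the matrix with rows [w i] has a right inverse, and its column [i0] is a linear
    functional that reads off the coefficient of [w i0]. *)
Lemma lin_indep_coord (w : 'I_k.+1 -> 'rV[R]_n) i0 : lin_indep w ->
  exists P : 'I_n -> R, forall c : 'I_k.+1 -> R,
    \sum_(j < n) (\sum_(i < k.+1) c i *: w i) ord0 j * P j = c i0.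
Proof.
move=> hw; pose M : 'M[R]_(k.+1, n) := \matrix_i w i.
have MS (v : 'rV[R]_k.+1) : v *m M = \sum_(i < k.+1) v ord0 i *: w i.
  by rewrite mulmx_sum_row; apply: eq_bigr => i _; rewrite rowK.
have fM : row_free M.
  rewrite -kermx_eq0; apply/eqP/row_matrixP => i; rewrite row0.
  apply/rowP => j; rewrite [RHS]mxE.
  apply: (hw (fun j => row i (kermx M) ord0 j) _ j).
  by rewrite -MS -row_mul mulmx_ker row0.
exists (fun j => pinvmx M j i0) => c.
transitivity (((\row_i c i) *m M *m pinvmx M) ord0 i0).
  rewrite mxE; apply: eq_bigr => j _; rewrite MS.
  by congr (_ * _); congr (fun_of_matrix _ _ _); apply: eq_bigr => i _; rewrite mxE.
by rewrite -mulmxA mulmxVp// mulmx1 mxE.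
Qed.

Lemma Cc_bounded (f : 'rV[R]_n -> R) : Cc f -> exists2 M, 0 <= M & forall v, `|f v| <= M.
Proof.
move=> [cf [K [cK fK]]].
have /compact_bounded [M [_ HM]] : compact (f @` K).
  by apply: continuous_compact => //; exact: continuous_subspaceT.
exists (Num.max 0 (M + 1)); first by rewrite le_max lexx.
move=> v; case: (pselect (K v)) => Kv; last by rewrite fK// normr0 le_max lexx.
rewrite le_max; apply/orP; right; apply: (HM (M + 1)); first by rewrite ltrDl.
by exists v.
Qed.

Lemma Cc_coord_bound (w : 'I_k.+1 -> 'rV[R]_n) (f : 'rV[R]_n -> R) i0 :
  lin_indep w -> Cc f ->
  exists U, forall c : 'I_k.+1 -> R, expR U < c i0 -> f (\sum_(i < k.+1) c i *: w i) = 0.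
Proof.
move=> /(lin_indep_coord i0) [P hP] [cf [K [cK fK]]].
pose g (v : 'rV[R]_n) : R := \sum_(j < n) v ord0 j * P j.
have cg : continuous g.
  move=> v; apply: (@cvg_sumr R R _ _ (nbhs v)) => j _.
  by apply: (@cvgM _ _ (nbhs v)); [exact: coord_continuous|exact: cvg_cst].
have /compact_bounded [M [_ HM]] : compact (g @` K).
  by apply: continuous_compact => //; exact: continuous_subspaceT.
(* The maximum with 1 makes the bound positive, so that it is the exponential of [ln B]. *)
pose B := Num.max 1 (M + 1).
have B0 : 0 < B by rewrite lt_max ltr01.
exists (ln B) => c; rewrite lnK ?posrE// => Bc.
apply: fK => Kv; have := HM B; rewrite /B lt_max ltrDl ltr01 orbT => /(_ isT (c i0)).
move=> /(_ (ex_intro2 _ _ _ Kv (hP c))) /=.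
by apply/negP; rewrite -ltNge (lt_le_trans Bc)// ler_norm.
Qed.

Lemma cvg_comb (w : 'I_k.+1 -> 'rV[R]_n) (f : 'rV[R]_n -> R)
    (c_ : nat -> 'I_k.+1 -> R) (c : 'I_k.+1 -> R) : continuous f ->
  (forall i, c_ m i @[m --> \oo] --> c i) ->
  f (\sum_i c_ m i *: w i) @[m --> \oo] --> f (\sum_i c i *: w i).
Proof.
move=> cf hc; apply: continuous_cvg; first exact: cf.
by apply: cvg_sumr => i _; apply: cvgZr_tmp; exact: hc.
Qed.

Lemma Cc_funrpos (f : 'rV[R]_n -> R) : Cc f -> Cc (fun v => Num.max (f v) 0).
Proof.
move=> [cf [K [cK fK]]]; split; last by exists K; split => // v /fK ->; rewrite maxxx.
by move=> v; apply: (@continuous_max _ _ f (fun=> 0)); [exact: cf|exact: cst_continuous].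
Qed.

Lemma Cc_opp (f : 'rV[R]_n -> R) : Cc f -> Cc (fun v => - f v).
Proof.
move=> [cf [K [cK fK]]]; split; last by exists K; split => // v /fK ->; rewrite oppr0.
by move=> v; apply: (@cvgN _ _ _ (nbhs v)); exact: cf.
Qed.

End CompactSupport.

(** * The change of coordinates *)

Section Coordinates.
Context {R : realType} {r k : nat}.
Variables (lam : 'I_k.+1 -> 'I_r.+1 -> R) (chi : 'I_r.+1 -> R).
Hypothesis hm : forall j, 0 < mcoef lam j.
Local Notation V := (rfun R r.+1).
Local Notation m := (mcoef lam).
Local Notation a := (a_chi lam chi).
Local Notation I := (I_chi lam chi).
Local Notation j0 := (j0 lam chi).

Definition J_chi : {set 'I_r.+1} := (~: I) :\ j0.
Local Notation J := J_chi.

(** The c_j of the overview, defined for all j: positive on I and zero off I, because a is the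
    maximum of the ratios. *)
Definition slack (j : 'I_r.+1) : R := a * m j - chi j.

Lemma slack_gt0 j : j \in I -> 0 < slack j.
Proof. by rewrite inE ltr_pdivrMr// /slack subr_gt0. Qed.

Lemma slack_eq0 j : j \notin I -> slack j = 0.
Proof.
rewrite inE -leNgt => h.
have : chi j / m j = a.
  by apply/eqP; rewrite eq_le h andbT; exact: (le_bigmax _ (fun j => chi j / m j) j).
by move=> e; rewrite /slack -e divfK ?gt_eqF// subrr.
Qed.

Lemma j0_notin : j0 \notin I.
Proof.
rewrite /Defs.j0; case: pickP => [j /=|h]; first by rewrite finset.in_setC.
(* In the default case of [odflt], all ratios would lie strictly below their own maximum. *)
have aI j : chi j / m j < a.
  by have := h j; rewrite /= finset.in_setC => /negbFE; rewrite inE.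
suff : a < a by rewrite ltxx.
by rewrite {1}/a_chi; apply/bigmax_ltP; split => // j _; exact: aI.
Qed.

Lemma in_J j : (j \in J) = (j != j0) && (j \notin I).
Proof. by rewrite !inE. Qed.

Lemma split_sum (F : 'I_r.+1 -> R) :
  \sum_j F j = \sum_(j in I) F j + F j0 + \sum_(j in J) F j.
Proof.
rewrite (bigID (mem I))/= -addrA; congr (_ + _).
rewrite (bigD1 j0) ?j0_notin//=; congr (_ + _).
by apply: eq_bigl => j; rewrite in_J andbC.
Qed.

Definition lam1_I (x : V) : R := \sum_(l in I) m l * x l.
Definition lam1_J (x : V) : R := \sum_(l in J) m l * x l.

(* With tau = log T; the coordinate j0 is chosen so that lambda_1 = x j0 + tau. *)
Definition chart (tau : R) (x : V) : V :=
  fun j => if j \in I then x j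
           else if j == j0 then (x j0 + tau - lam1_I x - tau * lam1_J x) / m j0
           else tau * x j.

(** At tau = 0 the chart is the section used by [L_chi], so identities and measurability proved for
    [chart] pass to [sec]. *)
Lemma chart0 (x : V) : chart 0 x = sec lam chi x.
Proof.
apply/funext => j; rewrite /chart /sec; case: ifP => // _; case: ifP => _.
  by rewrite addr0 mul0r subr0.
by rewrite mul0r.
Qed.

Lemma chart_I tau x j : j \in I -> chart tau x j = x j.
Proof. by rewrite /chart => ->. Qed.

Lemma chart_J tau x j : j \in J -> chart tau x j = tau * x j.
Proof. by rewrite in_J /chart => /andP[/negbTE -> /negbTE ->]. Qed.

Lemma chart_j0 tau x : chart tau x j0 = (x j0 + tau - lam1_I x - tau * lam1_J x) / m j0.
Proof. by rewrite /chart (negbTE j0_notin) eqxx. Qed.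

Lemma evf_chart_lam0 tau x : evf (lam ord0) (chart tau x) = x j0 + tau.
Proof.
rewrite /evf split_sum (eq_bigr (fun l => m l * x l)); last first.
  by move=> l lI; rewrite chart_I.
rewrite [X in _ + X](eq_bigr (fun l => tau * (m l * x l))); last first.
  by move=> l lJ; rewrite chart_J// mulrCA.
rewrite -mulr_sumr chart_j0 mulrC divfK ?gt_eqF// -/(lam1_I x) -/(lam1_J x).
ring.
Qed.

Lemma evf_chi (y : V) :
  evf chi y = a * evf (lam ord0) y - \sum_(j in I) slack j * y j.
Proof.
rewrite /evf mulr_sumr.
have -> : \sum_(j in I) slack j * y j = \sum_j slack j * y j.
  rewrite [RHS](bigID (mem I))/= [X in _ + X]big1 ?addr0// => j jI.
  by rewrite slack_eq0// mul0r.
by rewrite -sumrB; apply: eq_bigr => j _; rewrite /slack /mcoef; ring.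
Qed.

Lemma evf_chi_chart tau x :
  evf chi (chart tau x) = a * (x j0 + tau) - \sum_(j in I) slack j * x j.
Proof.
rewrite evf_chi evf_chart_lam0; congr (_ - _).
by apply: eq_bigr => j jI; rewrite chart_I.
Qed.

Lemma evf_chi_sec x :
  evf chi (sec lam chi x) = a * x j0 - \sum_(j in I) slack j * x j.
Proof. by rewrite -chart0 evf_chi_chart addr0. Qed.

Lemma evf_lam i (y : V) :
  evf (lam i) y = evf (lam ord0) y - \sum_j mcoef_i lam i j * y j.
Proof.
by rewrite /evf -sumrB; apply: eq_bigr => j _; rewrite /mcoef_i; ring.
Qed.

Lemma measurable_lin (D : {set 'I_r.+1}) :
  measurable_fun [set: V] (fun x : V => \sum_(l in D) m l * x l).
Proof.
rewrite (_ : (fun x : V => _) =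
    (fun x : V => \sum_l (if l \in D then m l * x l else 0))); last first.
  by apply/funext => x; rewrite big_mkcond.
apply: measurable_sum => l; case: (l \in D) => //.
by apply: measurable_funM => //; exact: measurable_coord.
Qed.

Lemma measurable_chart tau : measurable_fun [set: V] (chart tau : V -> V).
Proof.
apply: measurable_fun_coords => j; rewrite /chart; case: (j \in I).
  exact: measurable_coord.
case: (j == j0); last by apply: measurable_funM => //; exact: measurable_coord.
apply: measurable_funM => //; apply: measurable_funB; last first.
  by apply: measurable_funM => //; exact: measurable_lin.
apply: measurable_funB; last exact: measurable_lin.
by apply: measurable_funD => //; exact: measurable_coord.
Qed.

Local Notation s1 := (enum (j0 |: I)).
Local Notation s2 := (enum J).

(** The coordinates of J go innermost: the integrand of [L_chi] is constant in them and will factor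
    out. *)
Lemma perm_split : perm_eq (enum 'I_r.+1) (s1 ++ s2).
Proof.
apply: uniq_perm; first exact: enum_uniq.
  rewrite cat_uniq !enum_uniq /= andbT; apply/hasPn => j.
  rewrite !mem_enum /= in_J finset.in_setU1 => /andP[/negbTE -> /negbTE ->] //.
move=> j; rewrite mem_cat !mem_enum in_J finset.in_setU1.
by case: eqP => //= _; case: (j \in I).
Qed.

Lemma perm_compl : perm_eq (enum (~: I)) (s2 ++ [:: j0]).
Proof.
apply: uniq_perm; first exact: enum_uniq.
  by rewrite cat_uniq enum_uniq /= orbF andbT mem_enum in_J eqxx.
move=> j; rewrite mem_cat !mem_enum in_J mem_seq1.
by rewrite finset.in_setC; case: eqP => [->|]; rewrite ?j0_notin //= ?orbF.
Qed.

Lemma b_chi_pred : (b_chi lam chi).-1 = #|J|.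
Proof.
rewrite /b_chi (cardsD1 j0) finset.in_setC j0_notin //=.
Qed.

(** [chart tau] is the dilation of the J coordinates followed by an affine change of the single
    coordinate [j0], so that no multidimensional change of variables is required. *)
Lemma iint_chart (g : V -> \bar R) tau x : 0 < tau -> mge0 g ->
  iint (enum 'I_r.+1) g x =
  ((tau ^+ #|J| / m j0)%:E * iint (s1 ++ s2) (g \o chart tau) x)%E.
Proof.
move=> tau0 mg; rewrite (iint_perm mg perm_split).
have us : uniq (s1 ++ s2) by rewrite -(perm_uniq perm_split) enum_uniq.
pose B (y : V) := (tau - lam1_I y - lam1_J y) / m j0.
have mB : measurable_fun [set: V] B.
  apply: measurable_funM => //.
  by apply: measurable_funB; [apply: measurable_funB => //|]; exact: measurable_lin.
have sum_upd (D : {set 'I_r.+1}) (y : V) t : j0 \notin D ->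
    \sum_(l in D) m l * upd y j0 t l = \sum_(l in D) m l * y l.
  move=> j0D; apply: eq_bigr => l lD; rewrite /upd; case: eqP => // e.
  by move: j0D; rewrite -e lD.
have j0J : j0 \notin J by rewrite in_J eqxx.
rewrite (@iint_affine _ _ _ j0 (m j0)^-1 B)//; last 3 first.
- by rewrite mem_cat mem_enum finset.in_setU1 eqxx.
- by rewrite invr_gt0.
- by move=> y t; rewrite /B /lam1_I /lam1_J !sum_upd// j0_notin.
set g' := fun y => _.
have mg' : mge0 g'.
  apply: (mge0_comp (F := fun y : V => upd y j0 ((m j0)^-1 * y j0 + B y))) => //.
  apply: measurable_fun_coords => j; rewrite /upd; case: (j == j0).
    apply: measurable_funD; last exact: mB.
    by apply: measurable_funM => //; exact: measurable_coord.
  exact: measurable_coord.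
rewrite (iint_scale (s := s1 ++ s2) (s' := s2) x us (enum_uniq _) _ tau0 mg'); last first.
  by move=> j js; rewrite mem_cat js orbT.
rewrite muleA -EFinM -cardE mulrC; congr (_ * iint _ _ x)%E.
apply/funext => y; rewrite /g' /=; congr (g _); apply/funext => j.
case: (eqVneq j j0) => [->|jj0]; last first.
  rewrite /upd (negbTE jj0) /scale_coords mem_enum in_J jj0 /chart (negbTE jj0) /=.
  by case: (j \in I).
rewrite /upd eqxx chart_j0 /B.
have -> : scale_coords tau s2 y j0 = y j0.
  by rewrite /scale_coords mem_enum (negbTE j0J).
have -> : lam1_I (scale_coords tau s2 y) = lam1_I y.
  apply: eq_bigr => l lI; rewrite /scale_coords mem_enum in_J lI andbF//.
have -> : lam1_J (scale_coords tau s2 y) = tau * lam1_J y.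
  rewrite /lam1_J mulr_sumr; apply: eq_bigr => l lJ.
  by rewrite /scale_coords mem_enum lJ mulrCA.
by rewrite [(m j0)^-1 * _]mulrC -mulrDl; congr (_ / _); ring.
Qed.

End Coordinates.

(** * The integrands, their majorant and their pointwise limit *)

Lemma measurable_forallb d (T : measurableType d) (I : finType) (P : I -> T -> bool) :
  (forall i, measurable_fun [set: T] (P i)) ->
  measurable_fun [set: T] (fun x => [forall i, P i x]).
Proof.
move=> mP; rewrite (_ : (fun x => _) = (fun x => \big[andb/true]_i P i x)); last first.
  by apply/funext => x; rewrite big_andE.
elim: (index_enum I) => [|i s IH].
  rewrite (_ : (fun x => _) = (fun=> true))//.
  by apply/funext => x; rewrite big_nil.
rewrite (_ : (fun x => _) = (fun x => P i x && \big[andb/true]_(j <- s) P j x)).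
  exact: measurable_and.
by apply/funext => x; rewrite big_cons.
Qed.

Section Integrands.
Context {R : realType} {r n k : nat}.
Variables (w : 'I_k.+1 -> 'rV[R]_n) (lam : 'I_k.+1 -> 'I_r.+1 -> R).
Variable chi : 'I_r.+1 -> R.
Hypothesis hm : forall j, 0 < mcoef lam j.
Hypothesis hmi : forall i j, 0 <= mcoef_i lam i j.
Hypothesis hachi : 0 < a_chi lam chi.
Variable f : 'rV[R]_n -> R.
Hypothesis cf : continuous f.
Hypothesis f0 : forall v, 0 <= f v.
Variables M U : R.
Hypothesis fM : forall v, f v <= M.
Hypothesis fU : forall c : 'I_k.+1 -> R, expR U < c ord0 -> f (\sum_(i < k.+1) c i *: w i) = 0.
Local Notation V := (rfun R r.+1).
Local Notation mu := (@lebesgue_measure R).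
Local Notation m := (mcoef lam).
Local Notation a := (a_chi lam chi).
Local Notation I := (I_chi lam chi).
Local Notation J := (J_chi lam chi).
Local Notation j0 := (j0 lam chi).
Local Notation s1 := (enum (j0 |: I)).
Local Notation s2 := (enum J).
Local Notation slack := (slack lam chi).
Local Notation pt := (chart lam chi).
Local Notation sumI := (lam1_I lam chi).
Local Notation sumJ := (lam1_J lam chi).
Local Notation sec := (sec lam chi).
Local Notation mi := (mcoef_i lam).

Definition lhs_integrand (T : R) (x : V) : R :=
  if [forall j, 0 <= x j] then f (T^-1 *: phi w lam x) * expR (evf chi x) else 0.

Definition L_integrand (x : V) : R :=
  if [forall j in I, 0 <= x j] then f (psi w lam chi (sec x)) * expR (evf chi (sec x)) else 0.

Definition simplex_indic (x : V) : R :=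
  if [forall j in J, 0 <= x j] && (sumJ x <= 1) then 1 else 0.

(** Here T = e^tau, and the exponential prefactor is the T^(-a) of the normalisation. *)
Definition rescaled_integrand (tau : R) (x : V) : R :=
  expR (- (a * tau)) * lhs_integrand (expR tau) (pt tau x).

Lemma M_ge0 : 0 <= M. Proof. exact: le_trans (f0 0) (fM 0). Qed.

Lemma evf_cvg (c : 'I_r.+1 -> R) (u : nat -> V) (x : V) :
  (forall j, u p j @[p --> \oo] --> x j) -> evf c (u p) @[p --> \oo] --> evf c x.
Proof.
move=> ux; apply: cvg_sumr => j _.
by apply: cvgM; [exact: cvg_cst|exact: ux].
Qed.

Lemma measurable_comb (S : pred 'I_k.+1) (T : R) : measurable_fun [set: V]
  (fun x => f (T *: \sum_(i | S i) expR (evf (lam i) x) *: w i) * expR (evf chi x)).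
Proof.
apply: measurable_seq_continuous => u x ux; apply: cvgM.
  apply: continuous_cvg; first exact: cf.
  apply: cvgZl_tmp; apply: cvg_sumr => i _; apply: cvgZr_tmp.
  by apply: continuous_cvg; [exact: continuous_expR|exact: evf_cvg].
by apply: continuous_cvg; [exact: continuous_expR|exact: evf_cvg].
Qed.

Lemma measurable_nneg (D : pred 'I_r.+1) :
  measurable_fun [set: V] (fun x : V => [forall (j | D j), 0 <= x j]).
Proof.
apply: measurable_forallb => j; case: (D j) => //=.
by apply: measurable_fun_ler => //; exact: measurable_coord.
Qed.

Lemma mge0_EFin (g : V -> R) : measurable_fun [set: V] g -> (forall x, 0 <= g x) ->
  mge0 (fun x => (g x)%:E).
Proof. by move=> mg g0; split; [exact/measurable_EFinP|move=> x; rewrite lee_fin]. Qed.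

Lemma lhs_integrand_ge0 T x : 0 <= lhs_integrand T x.
Proof. by rewrite /lhs_integrand; case: ifP => // _; rewrite mulr_ge0// expR_ge0. Qed.

Lemma measurable_lhs_integrand T : measurable_fun [set: V] (lhs_integrand T).
Proof.
apply: measurable_fun_ifT => //; last exact: (measurable_comb predT).
exact: (measurable_nneg predT).
Qed.

Lemma rescaled_integrand_ge0 tau x : 0 <= rescaled_integrand tau x.
Proof. by rewrite mulr_ge0 ?expR_ge0 ?lhs_integrand_ge0. Qed.

Lemma measurable_rescaled_integrand tau : measurable_fun [set: V] (rescaled_integrand tau).
Proof.
apply: measurable_funM => //.
by apply: (measurableT_comp (measurable_lhs_integrand _)); exact: measurable_chart.
Qed.

Lemma L_integrand_ge0 x : 0 <= L_integrand x.
Proof. by rewrite /L_integrand; case: ifP => // _; rewrite mulr_ge0// expR_ge0. Qed.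

Lemma measurable_L_integrand : measurable_fun [set: V] L_integrand.
Proof.
apply: measurable_fun_ifT => //; first exact: (measurable_nneg (mem I)).
pose g x := f (1 *: \sum_(i | supp_in_I lam chi i) expR (evf (lam i) x) *: w i) * expR (evf chi x).
rewrite (_ : (fun x : V => _) = g \o (pt 0 : V -> V)).
  by apply: (measurableT_comp (measurable_comb _ _)); exact: measurable_chart.
by apply/funext => x; rewrite /g /= scale1r chart0.
Qed.

Lemma simplex_indic_ge0 x : 0 <= simplex_indic x.
Proof. by rewrite /simplex_indic; case: ifP. Qed.

Lemma measurable_simplex_indic : measurable_fun [set: V] simplex_indic.
Proof.
apply: measurable_fun_ifT => //; apply: measurable_and.
  exact: (measurable_nneg (mem J)).
by apply: measurable_fun_ler => //; exact: measurable_lin.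
Qed.

(** Since lambda_1 = u + tau in the chart, T^(-1) cancels tau in each exponent lambda_i and T^(-a)
    cancels it in chi. The parameter survives only through the values alpha_j of the chart point. *)
Lemma rescaled_integrandE tau x : rescaled_integrand tau x =
  if [forall j, 0 <= pt tau x j] then
    f (\sum_i expR (x j0 - \sum_j mi i j * pt tau x j) *: w i) * expR (evf chi (sec x))
  else 0.
Proof.
rewrite /rescaled_integrand /lhs_integrand; case: ifP => _; last by rewrite mulr0.
rewrite mulrCA -expRD; congr (f _ * expR _); last first.
  by rewrite evf_chi_chart// evf_chi_sec//; ring.
rewrite /phi scaler_sumr; apply: eq_bigr => i _; rewrite scalerA; congr (_ *: _).
by rewrite evf_lam evf_chart_lam0// -expRN -expRD; congr expR; ring.
Qed.

Lemma mi_supp i j : supp_in_I lam chi i -> j \notin I -> mi i j = 0.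
Proof.
move=> /forallP/(_ j)/implyP h jI; apply/eqP; rewrite eq_le hmi andbT leNgt.
by apply/negP => /h; apply/negP.
Qed.

(** As a sum over all i with zero coefficients allowed, psi can be compared with phi / T coefficient
    by coefficient, and the bound on the coefficient of w_1 applies to it too. *)
Lemma psi_sec x : psi w lam chi (sec x) =
  \sum_i (if supp_in_I lam chi i then expR (x j0 - \sum_(j in I) mi i j * x j) else 0) *: w i.
Proof.
rewrite /psi big_mkcond; apply: eq_bigr => i _; case: ifPn => si; last by rewrite scale0r.
congr (expR _ *: _); rewrite -chart0 evf_lam evf_chart_lam0// addr0; congr (_ - _).
rewrite (bigID (mem I))/= [X in _ + X]big1 ?addr0; last first.
  by move=> j jI; rewrite mi_supp// mul0r.
by apply: eq_bigr => j jI; rewrite chart_I.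
Qed.

Lemma mi0 j : mi ord0 j = 0. Proof. by rewrite /mcoef_i subrr. Qed.

Lemma supp0 : supp_in_I lam chi ord0.
Proof. by apply/forallP => j; rewrite mi0 ltxx. Qed.

(** One family serves two majorants: [hJ] is constantly 1 for [L_integrand], where J is not
    integrated, and the indicator of a segment for the rescaled integrand. *)
Definition hfun (hJ : 'I_r.+1 -> R -> R) (j : 'I_r.+1) (t : R) : R :=
  if j \in I then expneg_half (slack j) t
  else if j == j0 then exppos_half a U t else hJ j t.

Lemma hfun_fin (hJ : 'I_r.+1 -> R -> R) (s : seq 'I_r.+1) :
  (forall j t, 0 <= hJ j t) -> (forall j, measurable_fun [set: R] (hJ j)) ->
  (forall j, j \in s -> j \in J -> (\int[mu]_t (hJ j t)%:E < +oo)%E) ->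
  mge0 (fun x : V => (M * \prod_j hfun hJ j (x j))%:E) /\
  iint_fin s (fun x : V => (M * \prod_j hfun hJ j (x j))%:E).
Proof.
move=> hJ0 mhJ fhJ; apply: iint_prod_fin; first exact: M_ge0.
- move=> j t; rewrite /hfun /expneg_half /exppos_half.
  by case: ifP => _; [|case: ifP => _]; do ?case: ifP => _; rewrite ?expR_ge0.
- move=> j; rewrite /hfun; case: (j \in I); first exact: measurable_expneg_half.
  by case: (j == j0) => //; exact: measurable_exppos_half.
- move=> j js; rewrite /hfun; have [jI|jI] := boolP (j \in I).
    exact/integral_expneg_half/slack_gt0.
  have [jj0|jj0] := boolP (j == j0); first exact: integral_exppos_half.
  by apply: fhJ => //; rewrite in_J jj0.
Qed.

Lemma expR_sum (K : Type) (s : seq K) (P : pred K) (F : K -> R) :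
  expR (\sum_(i <- s | P i) F i) = \prod_(i <- s | P i) expR (F i).
Proof. by elim/big_rec2: _ => [|i y1 y2 _ <-]; rewrite ?expR0 ?expRD. Qed.

Lemma prod_hfun (hJ : 'I_r.+1 -> R -> R) (x : V) : (forall j, j \in I -> 0 <= x j) -> x j0 <= U ->
  (forall j, j \in J -> hJ j (x j) = 1) ->
  \prod_j hfun hJ j (x j) = expR (evf chi (sec x)).
Proof.
move=> xI xU xJ; rewrite evf_chi_sec// -sumrN expRD expR_sum [RHS]mulrC.
rewrite (bigID (mem I))/= [X in _ * X](bigD1 j0) ?j0_notin//=; congr (_ * _).
  apply: eq_bigr => j jI; rewrite /hfun jI /expneg_half xI//.
rewrite /hfun (negbTE (j0_notin lam chi)) eqxx /exppos_half xU big1 ?mulr1// => j /andP[jI jj0].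
by rewrite (negbTE jI) (negbTE jj0) xJ// in_J jj0.
Qed.

Lemma hfun_ge0 (hJ : 'I_r.+1 -> R -> R) (x : V) : (forall j t, 0 <= hJ j t) ->
  0 <= M * \prod_j hfun hJ j (x j).
Proof.
move=> h0; rewrite mulr_ge0 ?M_ge0// prodr_ge0// => j _.
rewrite /hfun /expneg_half /exppos_half.
by case: ifP => _; [|case: ifP => _]; do ?case: ifP => _; rewrite ?expR_ge0.
Qed.

Lemma L_integrand_le x : L_integrand x <= M * \prod_j hfun (fun _ _ => 1) j (x j).
Proof.
rewrite /L_integrand; case: ifPn => [/forall_inP xI|_]; last exact: hfun_ge0.
(* The coefficient of w_1 is exp u, so f vanishes once u > U. *)
have [xU|xU] := leP (x j0) U; last first.
  rewrite psi_sec fU ?mul0r ?hfun_ge0// supp0 big1 ?subr0 ?ltr_expR//.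
  by move=> j _; rewrite mi0 mul0r.
by rewrite prod_hfun// ler_wpM2r ?expR_ge0.
Qed.

(** Origin of the constant: alpha_(j0) >= 0 gives tau lambda_1(s) <= u + tau <= U + tau, hence
    lambda_1(s) <= 1 + |U| as soon as tau >= 1, and each m_j s_j is at most lambda_1(s). *)
Definition rescaled_bound (x : V) : R :=
  M * \prod_j hfun (fun j => indic_seg ((1 + `|U|) / m j)) j (x j).

Lemma indic_seg_ge0 (C t : R) : 0 <= indic_seg C t.
Proof. by rewrite /indic_seg; case: ifP. Qed.

Lemma rescaled_integrand_le tau x : 1 <= tau -> rescaled_integrand tau x <= rescaled_bound x.
Proof.
move=> tau1; have tau0 : 0 < tau by apply: lt_le_trans tau1.
have hb0 : 0 <= rescaled_bound x by apply: hfun_ge0 => j t; exact: indic_seg_ge0.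
rewrite rescaled_integrandE; case: ifPn => [/forallP xpt|_]; last by [].
have xI j : j \in I -> 0 <= x j by move=> jI; have := xpt j; rewrite chart_I.
have xJ j : j \in J -> 0 <= x j.
  by move=> jJ; have := xpt j; rewrite chart_J// pmulr_rge0.
have [xU|xU] := leP (x j0) U; last first.
  rewrite fU ?mul0r// big1 ?subr0 ?ltr_expR// => j _.
  by rewrite mi0 mul0r.
have sI : 0 <= sumI x by apply: sumr_ge0 => l lI; rewrite mulr_ge0 ?xI// ltW.
have sJ : sumJ x <= 1 + `|U|.
  have := xpt j0; rewrite chart_j0// pmulr_lge0 ?invr_gt0// => h.
  rewrite -(ler_pM2l tau0); have UU := ler_norm U; have U0 := normr_ge0 U.
  nra.
rewrite /rescaled_bound prod_hfun//; first by rewrite ler_wpM2r ?expR_ge0.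
move=> j jJ; rewrite /indic_seg xJ//= ler_pdivlMr// mulrC.
rewrite (le_trans _ sJ)//.
rewrite /lam1_J (bigD1 j)//= lerDl; apply: sumr_ge0 => l /andP[lJ _].
by rewrite mulr_ge0 ?xJ// ltW.
Qed.

Lemma cvg_affine_pinfty (p q : R) (tau : nat -> R) : 0 < q ->
  tau d @[d --> \oo] --> +oo -> p + q * tau d @[d --> \oo] --> +oo.
Proof.
move=> q0 /cvgryPge ht; apply/cvgryPge => A.
near=> d; rewrite -lerBlDl mulrC -ler_pdivrMr//; near: d; exact: ht.
Unshelve. all: by end_near. Qed.

(** Outside I each coordinate is affine in tau, with slope s_j on J and (1 - lambda_1(s)) / m_(j0)
    at [j0]; inside the open simplex all these slopes are positive. *)
Lemma chart_cvg (tau : nat -> R) x j : tau d @[d --> \oo] --> +oo ->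
  (forall l, l \in J -> 0 < x l) -> sumJ x < 1 -> j \notin I ->
  pt (tau d) x j @[d --> \oo] --> +oo.
Proof.
move=> ht xJ sJ jI; case: (eqVneq j j0) => [->|jj0].
  under eq_cvg.
    move=> d; rewrite chart_j0// (_ : _ / _ =
      (x j0 - sumI x) / m j0 + (1 - sumJ x) / m j0 * tau d); last by field; rewrite gt_eqF.
    over.
  by apply: cvg_affine_pinfty => //; rewrite divr_gt0// subr_gt0.
have jJ : j \in J by rewrite in_J jj0.
under eq_cvg do rewrite chart_J// mulrC -[_ * _]add0r.
exact: cvg_affine_pinfty (xJ _ jJ) ht.
Qed.

Lemma rescaled_integrand_cvg (tau : nat -> R) x :
  (forall d, 1 <= tau d) -> tau d @[d --> \oo] --> +oo ->
  (forall j, j \in J -> x j <> 0) -> sumJ x <> 1 ->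
  rescaled_integrand (tau d) x @[d --> \oo] --> L_integrand x * simplex_indic x.
Proof.
move=> tau1 htau xJ0 sJ1.
have tau0 d : 0 < tau d by apply: lt_le_trans (tau1 d).
have [xI|] := boolP [forall j in I, 0 <= x j]; last first.
  move=> nI; rewrite /L_integrand (negbTE nI) mul0r.
  apply: cvg_near_cst; near=> d; rewrite rescaled_integrandE ifF//.
  apply/negbTE; move: nI; apply: contra => /forallP h; apply/forall_inP => j jI.
  by have := h j; rewrite chart_I.
have [xJ|] := boolP [forall j in J, 0 <= x j]; last first.
  move=> nJ; rewrite /simplex_indic (negbTE nJ) mulr0.
  apply: cvg_near_cst; near=> d; rewrite rescaled_integrandE ifF//.
  apply/negbTE; move: nJ; apply: contra => /forallP h; apply/forall_inP => j jJ.
  by have := h j; rewrite chart_J// pmulr_rge0.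
have [sJ|sJ|//] := ltgtP (sumJ x) 1; last first.
  rewrite /simplex_indic leNgt sJ andbF mulr0.
  apply: cvg_near_cst.
  (* Beyond the simplex the coordinate [j0] is eventually negative, so the integrand is eventually
     0. *)
  have : (sumI x - x j0) + (sumJ x - 1) * tau d @[d --> \oo] --> +oo.
    by apply: cvg_affine_pinfty => //; rewrite subr_gt0.
  move=> /cvgryPgt/(_ 0); apply: filterS => d hd; rewrite rescaled_integrandE ifF//.
  apply/negbTE/negP => /forallP/(_ j0); rewrite chart_j0// pmulr_lge0 ?invr_gt0// leNgt.
  by move/negP; apply; lra.
have xJ' l : l \in J -> 0 < x l.
  by move=> lJ; rewrite lt_neqAle (forall_inP xJ)// andbT eq_sym; apply/eqP/xJ0.
have hpt : \forall d \near \oo, forall j, 0 <= pt (tau d) x j.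
  apply: filter_forall => j; have [jI|jI] := boolP (j \in I).
    by near=> d; rewrite chart_I// (forall_inP xI).
  by have /cvgryPge := chart_cvg htau xJ' sJ jI; exact.
rewrite /simplex_indic xJ (ltW sJ) /= mulr1 /L_integrand xI.
have key : f (\sum_i expR (x j0 - \sum_j mi i j * pt (tau d) x j) *: w i) *
    expR (evf chi (sec x)) @[d --> \oo] -->
    f (psi w lam chi (sec x)) * expR (evf chi (sec x)).
  apply: cvgM; last exact: cvg_cst.
  rewrite psi_sec; apply: (cvg_comb
    (c_ := fun d i => expR (x j0 - \sum_j mi i j * pt (tau d) x j))) => //.
  move=> i; case: ifPn => [si|nsi].
    apply: cvg_near_cst; near=> d; congr expR; congr (_ - _).
    rewrite (bigID (mem I))/= [X in _ + X]big1 ?addr0; last first.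
      by move=> j jI; rewrite mi_supp// mul0r.
    by apply: eq_bigr => j jI; rewrite chart_I.
  (* A root j outside I with m_(i,j) > 0 forces the i-th coefficient to 0, since alpha_j tends to
     +oo and the other terms of the sum only decrease the exponent. *)
  have /existsP[j] : [exists j, (0 < mi i j) && (j \notin I)].
    apply: contraNT nsi; rewrite negb_exists => /forallP h; apply/forallP => j.
    by apply/implyP => mij; have := h j; rewrite mij /= negbK.
  move=> /andP[mij jI].
  apply: (@squeeze_cvgr _ _ _ _ (fun=> 0)
    (fun d => expR (- (- x j0 + mi i j * pt (tau d) x j)))); last 2 first.
  - exact: cvg_cst.
  - apply: (@cvg_comp _ _ _ (fun d => - x j0 + mi i j * pt (tau d) x j)
      (fun y => expR (- y)) _ (pinfty_nbhs R)); last exact: cvgr_expR.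
    by apply: cvg_affine_pinfty => //; exact: chart_cvg.
  near=> d; rewrite expR_ge0 ler_expR opprD opprK lerD2l lerN2.
  have hd : forall j, 0 <= pt (tau d) x j by near: d; exact: hpt.
  rewrite (bigD1 j)//= lerDl; apply: sumr_ge0 => l _.
  by rewrite mulr_ge0// hmi.
apply: cvg_trans key; apply: near_eq_cvg.
apply: filterS hpt => d /forallP hd; rewrite rescaled_integrandE.
by rewrite hd.
Unshelve. all: by end_near. Qed.

End Integrands.

Lemma ae_iint_all (R : realType) (r : nat) (s t : seq 'I_r)
    (P : 'I_r -> rfun R r -> Prop) (x : rfun R r) :
  (forall i, i \in t -> ae_iint s (P i) x) ->
  ae_iint s (fun y => forall i, i \in t -> P i y) x.
Proof.
elim: t => [|i t IH] h; first exact: ae_iintT.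
have a1 := h i (mem_head _ _).
have a2 := IH (fun j jt => h j (mem_behead (s := i :: t) jt)).
apply: ae_iint_impl (ae_iintI a1 a2) => y [Py Qy] j.
by rewrite inE => /orP[/eqP ->|/Qy].
Qed.

Lemma ae_neq (R : realType) (c : R) : {ae (@lebesgue_measure R), forall t, t <> c}.
Proof.
exists [set c]; split => //; first exact: lebesgue_measure_set1.
by move=> t /= /contrapT.
Qed.

(** * The volume of the slab *)

Section Slab.
Context {R : realType} {r k : nat}.
Variables (lam : 'I_k.+1 -> 'I_r.+1 -> R) (chi : 'I_r.+1 -> R).
Hypothesis hm : forall j, 0 < mcoef lam j.
Local Notation V := (rfun R r.+1).
Local Notation mu := (@lebesgue_measure R).
Local Notation m := (mcoef lam).
Local Notation I := (I_chi lam chi).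
Local Notation J := (J_chi lam chi).
Local Notation j0 := (j0 lam chi).
Local Notation s1 := (enum (j0 |: I)).
Local Notation s2 := (enum J).
Local Notation sumJ := (lam1_J lam chi).
Local Notation Bint := (simplex_indic lam chi).

Let j0J : j0 \notin J. Proof. by rewrite in_J eqxx. Qed.

Lemma lam1_J_upd (y : V) t : sumJ (upd y j0 t) = sumJ y.
Proof.
apply: eq_bigr => l lJ; rewrite /upd; case: eqP => // e.
by move: j0J; rewrite -e lJ.
Qed.

Definition simplex_vol : \bar R := iint s2 (fun x => (Bint x)%:E) (fun=> 0).

Lemma simplex_indic_dep (y z : V) : (forall j, j \in J -> y j = z j) -> Bint y = Bint z.
Proof.
move=> yz; rewrite /simplex_indic.
have -> : [forall j in J, 0 <= y j] = [forall j in J, 0 <= z j].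
  by apply: eq_forallb => j; case: (boolP (j \in J)) => //= jJ; rewrite yz.
by have -> : sumJ y = sumJ z by apply: eq_bigr => j jJ; rewrite yz.
Qed.

Lemma iint_simplex_indic x : iint s2 (fun x => (Bint x)%:E) x = simplex_vol.
Proof.
apply: (iint_dep (D := fun j => j \in J)) => [y z yz|j jJ]; last by rewrite mem_enum jJ.
by rewrite (simplex_indic_dep yz).
Qed.

Lemma mge0_simplex_indic : mge0 (fun x : V => (Bint x)%:E).
Proof. by apply: mge0_EFin; [exact: measurable_simplex_indic|exact: simplex_indic_ge0]. Qed.

(** The 2 comes from lambda_1(s) <= 1 + e x_(j0) <= 2 for e <= 1. The leading 1 is the constant
    expected by [iint_prod_fin]. *)
Definition slab_bound (x : V) : R :=
  1 * \prod_j (if j \in J then indic_seg (2 / m j) else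
               if j == j0 then indic_seg 1 else fun=> 1) (x j).

Lemma slab_bound_fin : mge0 (fun x => (slab_bound x)%:E) /\
  iint_fin (s2 ++ [:: j0]) (fun x => (slab_bound x)%:E).
Proof.
apply: (iint_prod_fin (h := fun j => if j \in J then indic_seg (2 / m j) else
               if j == j0 then indic_seg 1 else fun=> 1)) => // j.
- by move=> t; case: ifP => _; [|case: ifP => _]; rewrite ?indic_seg_ge0.
- by case: (j \in J); [|case: (j == j0)]; rewrite //; exact: measurable_indic_seg.
- rewrite mem_cat mem_enum mem_seq1; case: (j \in J) => /= [_|->].
    by rewrite integral_indic_seg ?ltry// divr_ge0// ltW.
  by rewrite integral_indic_seg ?ltry.
Qed.

(** The slab in coordinates where lambda_1 = 1 + e x_(j0): its thickness becomes the unit interval,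
    and nonnegativity of the old coordinate [j0] becomes the bound on [sumJ x]. *)
Definition slab_integrand (e : R) (x : V) : R :=
  if [forall j in J, 0 <= x j] && (sumJ x <= 1 + e * x j0) && (0 <= x j0 <= 1) then 1 else 0.

Lemma mge0_slab_integrand e : mge0 (fun x => (slab_integrand e x)%:E).
Proof.
apply: mge0_EFin; last by move=> x; rewrite /slab_integrand; case: ifP.
have mj0 : measurable_fun [set: V] (fun x : V => x j0) by exact: measurable_coord.
apply: measurable_fun_ifT => //; apply: measurable_and.
  apply: measurable_and; first exact: (measurable_nneg (mem J)).
  apply: measurable_fun_ler; first exact: measurable_lin.
  by apply: measurable_funD => //; exact: measurable_funM.
by apply: measurable_and; apply: measurable_fun_ler.
Qed.

Lemma lam1_J_ge (x : V) j : (forall j, j \in J -> 0 <= x j) -> j \in J -> m j * x j <= sumJ x.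
Proof.
move=> xJ jJ; rewrite /lam1_J (bigD1 j)//= lerDl; apply: sumr_ge0 => l /andP[lJ _].
by rewrite mulr_ge0 ?xJ// ltW.
Qed.

Lemma slab_integrand_le e x : 0 < e <= 1 -> slab_integrand e x <= slab_bound x.
Proof.
move=> /andP[e0 e1]; rewrite /slab_integrand /slab_bound mul1r.
have p0 : 0 <= \prod_j (if j \in J then indic_seg (2 / m j) else
               if j == j0 then indic_seg 1 else fun=> 1) (x j).
  by apply: prodr_ge0 => j _; case: ifP => _; [|case: ifP => _]; rewrite ?indic_seg_ge0.
case: ifPn => // /andP[/andP[/forall_inP xJ sJ] xj0].
rewrite big1// => j _; have [jJ|_] := boolP (j \in J).
  rewrite /indic_seg xJ//= ler_pdivlMr// mulrC ifT//.
  apply: le_trans (lam1_J_ge xJ jJ) _; move/andP: xj0 => [xj0 xj1]; nra.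
by case: eqP => // ->; rewrite /indic_seg xj0.
Qed.

Lemma slab_integrand_cvg (e : nat -> R) x :
  (forall d, 0 < e d <= 1) -> e d @[d --> \oo] --> (0 : R) ->
  slab_integrand (e d) x @[d --> \oo] --> Bint x * indic_seg 1 (x j0).
Proof.
move=> e1 he; rewrite /simplex_indic /slab_integrand /indic_seg.
case: [forall j in J, 0 <= x j] => /=; last by rewrite mul0r; exact: cvg_cst.
have [/andP[x0 x1]|_] := boolP (0 <= x j0 <= 1); last first.
  by rewrite mulr0; apply: cvg_near_cst; near=> d; rewrite andbF.
rewrite mulr1; have [sJ|sJ] := leP (sumJ x) 1.
  apply: cvg_near_cst; near=> d; rewrite ifT// andbT (le_trans sJ)// lerDl.
  by rewrite mulr_ge0//; have /andP[/ltW] := e1 d.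
apply: cvg_near_cst; near=> d; rewrite ifF// andbT; apply/negbTE; rewrite -ltNge.
have : e d < sumJ x - 1.
  by near: d; apply: (cvgr_lt 0) he _ _; rewrite subr_gt0.
have /andP[/ltW d0 _] := e1 d; nra.
Unshelve. all: by end_near. Qed.

Lemma slab_volE e : 0 < e ->
  ((e^-1)%:E * slab_vol lam chi e = ((m j0)^-1)%:E *
     iint (s2 ++ [:: j0]) (fun x => (slab_integrand e x)%:E) (fun=> 0%R))%E.
Proof.
move=> e0; rewrite /slab_vol.
pose S (z : V) : R := if [forall j in ~: I, 0 <= z j] &&
  (1 <= sumJ z + m j0 * z j0 <= 1 + e) then 1 else 0.
have mS : mge0 (fun z => (S z)%:E).
  apply: mge0_EFin; last by move=> x; rewrite /S; case: ifP.
  have mj0 : measurable_fun [set: V] (fun x : V => x j0) by exact: measurable_coord.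
  have ms : measurable_fun [set: V] (fun x : V => sumJ x + m j0 * x j0).
    by apply: measurable_funD; [exact: measurable_lin|exact: measurable_funM].
  apply: measurable_fun_ifT => //; apply: measurable_and.
    exact: (measurable_nneg (mem (~: I))).
  by apply: measurable_and; apply: measurable_fun_ler.
rewrite (@eq_iint_frozen _ _ _ _ (fun z => (S z)%:E)); last first.
  move=> y hy; rewrite /S.
  have -> : evf (lam ord0) y = sumJ y + m j0 * y j0.
    rewrite /evf (split_sum lam chi) big1 ?add0r 1?addrC// => j jI.
    by rewrite hy ?mulr0// mem_enum finset.in_setC negbK.
  have -> : [forall j, 0 <= y j] = [forall j in ~: I, 0 <= y j].
    apply: eq_forallb => j; have [//|jI] := boolP (j \in ~: I).
    by rewrite hy ?lexx// mem_enum.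
  by case: ifP.
have us : uniq (s2 ++ [:: j0]) by rewrite -(perm_uniq (perm_compl lam chi)) enum_uniq.
(* With slope e / m_(j0), this shift makes lambda_1 equal to 1 + e z_(j0); the factor e then cancels
   the division by e in kappa. *)
pose B (z : V) : R := (1 - sumJ z) / m j0.
have mB : measurable_fun [set: V] B.
  by apply: measurable_funM => //; apply: measurable_funB => //; exact: measurable_lin.
rewrite (iint_perm mS (perm_compl lam chi)).
rewrite (@iint_affine _ _ _ j0 (e / m j0) B)//; last 3 first.
- by rewrite mem_cat mem_seq1 eqxx orbT.
- by rewrite divr_gt0.
- by move=> y t; rewrite /B lam1_J_upd.
rewrite muleA -EFinM mulrA mulVf ?gt_eqF// mul1r; congr (_ * iint _ _ _)%E.
apply/funext => z; congr EFin; rewrite /S /slab_integrand lam1_J_upd.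
set z' := upd _ _ _.
have -> : z' j0 = (e * z j0 + 1 - sumJ z) / m j0.
  by rewrite /z' /upd eqxx /B mulrAC -mulrDl addrA.
have -> : sumJ z + m j0 * ((e * z j0 + 1 - sumJ z) / m j0) = 1 + e * z j0.
  by rewrite [m j0 * _]mulrC divfK ?gt_eqF//; ring.
have -> : [forall j in ~: I, 0 <= z' j] =
    [forall j in J, 0 <= z j] && (sumJ z <= 1 + e * z j0).
  have zj0 : (0 <= z' j0) = (sumJ z <= 1 + e * z j0).
    rewrite /z' /upd eqxx /B mulrAC -mulrDl pmulr_lge0 ?invr_gt0//.
    by rewrite addrA subr_ge0 addrC.
  have zj j : j != j0 -> z' j = z j by move=> jj0; rewrite /z' /upd (negbTE jj0).
  apply/forall_inP/andP => [h|[/forall_inP h1 h2] j].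
    split; last by rewrite -zj0 h// finset.in_setC j0_notin.
    apply/forall_inP => j; rewrite in_J => /andP[jj0 jI].
    by rewrite -zj// h// finset.in_setC.
  rewrite finset.in_setC => jI; have [->|jj0] := eqVneq j j0; first by rewrite zj0.
  by rewrite zj// h1// in_J jj0.
have -> // : (1 <= 1 + e * z j0 <= 1 + e) = (0 <= z j0 <= 1).
by rewrite lerDl lerD2l pmulr_rge0// -[X in _ * _ <= X]mulr1 ler_pM2l.
Qed.

Lemma simplex_indic_upd (y : V) i t : i \notin J -> Bint (upd y i t) = Bint y.
Proof.
move=> iJ; apply: simplex_indic_dep => j.
by rewrite /upd; case: eqP => // -> jJ; rewrite jJ in iJ.
Qed.

Lemma mge0_simplex_indic_seg : mge0 (fun x : V => (Bint x * indic_seg 1 (x j0))%:E).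
Proof.
apply: mge0_EFin => [|x]; last by rewrite mulr_ge0 ?simplex_indic_ge0 ?indic_seg_ge0.
apply: measurable_funM; first exact: measurable_simplex_indic.
exact: measurableT_comp (measurable_indic_seg 1) (measurable_coord j0).
Qed.

(** A dummy coordinate of unit length is inserted so that the simplex and the slab are integrated
    over the same list. *)
Lemma simplex_volE : simplex_vol =
  iint (s2 ++ [:: j0]) (fun x => (Bint x * indic_seg 1 (x j0))%:E) (fun=> 0).
Proof.
rewrite iint_cat; congr (iint _ _ _); apply/funext => x /=.
under eq_integral.
  move=> t _; rewrite {2}/upd eqxx simplex_indic_upd// EFinM; over.
rewrite ge0_integralZl_EFin ?simplex_indic_ge0//.
- by rewrite integral_indic_seg// mule1.
- by move=> t _; rewrite lee_fin indic_seg_ge0.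
- by apply/measurable_EFinP; exact: measurable_indic_seg.
Qed.

Lemma simplex_vol_fin : simplex_vol \is a fin_num.
Proof.
have [mQ fQ] := slab_bound_fin.
rewrite ge0_fin_numE; last exact: (mge0_iint s2 mge0_simplex_indic).2.
have us : uniq (s2 ++ [:: j0]) by rewrite -(perm_uniq (perm_compl lam chi)) enum_uniq.
rewrite simplex_volE; apply: (iint_fin_le mge0_simplex_indic_seg mQ _ fQ) => // x.
rewrite lee_fin; apply: le_trans (@slab_integrand_le 1 x _); last by rewrite ltr01 lexx.
rewrite /simplex_indic /indic_seg /slab_integrand mul1r.
case: [forall j in J, 0 <= x j] => /=; last by rewrite mul0r.
case: (boolP (0 <= x j0 <= 1)) => [/andP[x0 x1]|_]; last by rewrite mulr0 andbF.
case: (leP (sumJ x) 1) => [sJ|_]; last by rewrite mul0r; case: ifP.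
by rewrite mulr1 (le_trans sJ)// lerDl.
Qed.

Lemma kappa_chiE : kappa_chi lam chi = (((m j0)^-1)%:E * simplex_vol)%E.
Proof.
apply: cvg_lim => //; apply: cvg_at_right0_seq => u u1 u0.
have -> : (fun d => ((u d)^-1)%:E * slab_vol lam chi (u d))%E = (fun d => ((m j0)^-1)%:E *
     iint (s2 ++ [:: j0]) (fun x => (slab_integrand (u d) x)%:E) (fun=> 0%R))%E.
  by apply/funext => d; rewrite slab_volE//; have /andP[] := u1 d.
have [mQ fQ] := slab_bound_fin; have mB := mge0_simplex_indic.
have us : uniq (s2 ++ [:: j0]) by rewrite -(perm_uniq (perm_compl lam chi)) enum_uniq.
apply: cvgeZl => //.
rewrite simplex_volE.
(* There is no exceptional set here: on the face lambda_1(s) = 1 the slab condition already holds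
   for every e > 0, because e x_(j0) >= 0. *)
apply: (iint_dct (P := fun=> True) (h := fun x => (slab_bound x)%:E)) => //.
- by move=> d; exact: mge0_slab_integrand.
- exact: mge0_simplex_indic_seg.
- by move=> d y; rewrite lee_fin slab_integrand_le.
- exact: ae_iintT.
- by move=> y _; apply: cvg_EFin; [exact: nearW|exact: slab_integrand_cvg].
Qed.

End Slab.

(** * Asymptotics *)

Section Nonnegative.
Context {R : realType} {r n k : nat}.
Variables (w : 'I_k.+1 -> 'rV[R]_n) (lam : 'I_k.+1 -> 'I_r.+1 -> R).
Variable chi : 'I_r.+1 -> R.
Hypothesis hw : lin_indep w.
Hypothesis hm : forall j, 0 < mcoef lam j.
Hypothesis hmi : forall i j, 0 <= mcoef_i lam i j.
Hypothesis hachi : 0 < a_chi lam chi.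
Variable f : 'rV[R]_n -> R.
Hypothesis hf : Cc f.
Hypothesis f0 : forall v, 0 <= f v.
Local Notation V := (rfun R r.+1).
Local Notation m := (mcoef lam).
Local Notation a := (a_chi lam chi).
Local Notation I := (I_chi lam chi).
Local Notation J := (J_chi lam chi).
Local Notation j0 := (j0 lam chi).
Local Notation s1 := (enum (j0 |: I)).
Local Notation s2 := (enum J).
Local Notation sumJ := (lam1_J lam chi).
Local Notation Bint := (simplex_indic lam chi).
Local Notation Aint := (L_integrand w lam chi f).
Local Notation Hint := (rescaled_integrand w lam chi f).
Local Notation Gint := (lhs_integrand w lam chi f).

Let cf : continuous f. Proof. by case: hf. Qed.

Lemma Cc_bounds : exists M U, (forall v, f v <= M) /\
  forall c : 'I_k.+1 -> R, expR U < c ord0 -> f (\sum_(i < k.+1) c i *: w i) = 0.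
Proof.
have [M _ hM] := Cc_bounded hf; have [U hU] := Cc_coord_bound ord0 hw hf.
by exists M, U; split => // v; apply: le_trans (hM v); exact: ler_norm.
Qed.

Lemma mge0_lhs_integrand T : mge0 (fun x : V => (Gint T x)%:E).
Proof. by apply: mge0_EFin; [exact: measurable_lhs_integrand|exact: lhs_integrand_ge0]. Qed.

Lemma mge0_rescaled_integrand tau : mge0 (fun x : V => (Hint tau x)%:E).
Proof.
by apply: mge0_EFin; [exact: measurable_rescaled_integrand|exact: rescaled_integrand_ge0].
Qed.

Lemma mge0_L_integrand : mge0 (fun x : V => (Aint x)%:E).
Proof. by apply: mge0_EFin; [exact: measurable_L_integrand|exact: L_integrand_ge0]. Qed.

Lemma L_chiE : L_chi w lam chi f = iint s1 (fun x : V => (Aint x)%:E) (fun=> 0).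
Proof.
rewrite /L_chi; congr (iint _ _ _); apply/funext => x.
by rewrite /L_integrand; case: ifP.
Qed.

Lemma lhs_integralE T :
  lhs_integral w lam chi f T = iint (enum 'I_r.+1) (fun x : V => (Gint T x)%:E) (fun=> 0).
Proof.
rewrite /lhs_integral /leb_int; congr (iint _ _ _); apply/funext => x.
by rewrite /lhs_integrand; case: ifP.
Qed.

Lemma iint_fin_L_integrand : iint_fin s1 (fun x : V => (Aint x)%:E).
Proof.
have [M [U [hM hU]]] := Cc_bounds.
have [| |j|mh fh] := @hfun_fin _ _ n _ lam chi hm hachi f f0 M U hM (fun _ _ => 1) s1.
- by [].
- by move=> j; exact: measurable_cst.
- by rewrite mem_enum in_J finset.in_setU1 => /orP[->|-> /andP[]].
by apply: (iint_fin_le mge0_L_integrand mh _ fh) => x; rewrite lee_fin; exact: L_integrand_le.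
Qed.

Lemma L_chi_fin : L_chi w lam chi f \is a fin_num.
Proof.
rewrite L_chiE ge0_fin_numE; last exact: (mge0_iint s1 mge0_L_integrand).2.
by apply: iint_fin_L_integrand => //; exact: enum_uniq.
Qed.

(** Makes the splitting of a signed f legitimate at each fixed T. On the support lambda_1 <= U + ln
    T; as all coordinates are nonnegative, this confines them to a box, on which chi is bounded. *)
Lemma iint_fin_lhs_integrand T : 0 < T -> iint_fin (enum 'I_r.+1) (fun x : V => (Gint T x)%:E).
Proof.
move=> T0; have [M [U [hM hU]]] := Cc_bounds.
have M0 : 0 <= M := le_trans (f0 0) (hM 0).
pose D := Num.max 0 (U + ln T).
have D0 : 0 <= D by rewrite le_max lexx.
pose C := M * expR (\sum_j `|chi j| * (D / m j)).
have C0 : 0 <= C by rewrite mulr_ge0 ?expR_ge0.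
have [| | |mh fh] := @iint_prod_fin R r.+1 (enum 'I_r.+1) C (fun j => indic_seg (D / m j)) C0.
- by move=> j t; exact: indic_seg_ge0.
- by move=> j; exact: measurable_indic_seg.
- by move=> j _; rewrite integral_indic_seg ?ltry// divr_ge0// ltW.
apply: (iint_fin_le (mge0_lhs_integrand T) mh _ fh) => x; rewrite lee_fin /lhs_integrand.
have p0 : 0 <= C * \prod_j indic_seg (D / m j) (x j).
  by rewrite mulr_ge0// prodr_ge0// => j _; exact: indic_seg_ge0.
case: ifPn => // /forallP x0.
have [le|gt] := leP (evf (lam ord0) x) D; last first.
  rewrite /phi scaler_sumr (eq_bigr (fun i => (T^-1 * expR (evf (lam i) x)) *: w i)); last first.
    by move=> i _; rewrite scalerA.
  rewrite (hU (fun i => T^-1 * expR (evf (lam i) x))) ?mul0r//.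
  rewrite -[X in X^-1](@lnK _ T) ?posrE// -expRN -expRD ltr_expR.
  move: gt; rewrite /D gt_max => /andP[_]; lra.
have xD j : x j <= D / m j.
  rewrite ler_pdivlMr// mulrC; apply: le_trans le.
  rewrite /evf (bigD1 j)//= lerDl; apply: sumr_ge0 => l _.
  by rewrite mulr_ge0// ltW// hm.
rewrite big1 ?mulr1; last by move=> j _; rewrite /indic_seg x0 xD.
apply: ler_pM; rewrite ?expR_ge0//.
rewrite ler_expR; apply: ler_sum => j _.
apply: le_trans (ler_norm _) _; rewrite normrM ler_wpM2l// ger0_norm//.
Qed.

Lemma lhs_integral_rescaled_integrand T : 1 < T ->
  (((T `^ a * ln T ^+ (b_chi lam chi).-1)^-1)%:E * lhs_integral w lam chi f T =
   ((m j0)^-1)%:E * iint (s1 ++ s2) (fun x => (Hint (ln T) x)%:E) (fun=> 0%R))%E.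
Proof.
move=> T1; have T0 : 0 < T by apply: lt_trans T1.
have t0 : 0 < ln T by rewrite ln_gt0.
rewrite lhs_integralE (iint_chart chi hm _ t0 (mge0_lhs_integrand T)) b_chi_pred.
have e0 : 0 < expR (a * ln T) by exact: expR_gt0.
rewrite (_ : _ \o _ = fun x => ((expR (a * ln T))%:E * (Hint (ln T) x)%:E)%E); last first.
  apply/funext => x /=; rewrite -EFinM /rescaled_integrand lnK ?posrE//; congr EFin.
  by rewrite mulrA -expRD subrr expR0 mul1r.
rewrite (iintM (c := fun=> expR (a * ln T)))//; last exact: mge0_rescaled_integrand.
rewrite !muleA -!EFinM; congr (_%:E * _)%E.
rewrite /powR gt_eqF// .
field.
by rewrite !gt_eqF// exprn_gt0.
Qed.

Let us : uniq (s1 ++ s2). Proof. by rewrite -(perm_uniq (perm_split lam chi)) enum_uniq. Qed.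

Lemma ae_generic x :
  ae_iint (s1 ++ s2) (fun y : V => (forall j, j \in J -> y j <> 0) /\ sumJ y <> 1) x.
Proof.
apply: ae_iintI.
  have : ae_iint (s1 ++ s2) (fun y : V => forall j, j \in s2 -> y j <> 0) x.
    apply: ae_iint_all => j js.
    apply: (ae_iint_coord (P := fun t => t <> 0)) => //; last exact: ae_neq.
    by rewrite mem_cat js orbT.
  by apply: ae_iint_impl => y h j jJ; apply: h; rewrite mem_enum.
(* If J is empty, lambda_1(s) is the empty sum 0, never 1. *)
have [J0|[l lJ]] := set_0Vmem J.
  apply: ae_iintT => y; rewrite /lam1_J J0 big_set0; apply/eqP.
  by rewrite eq_sym oner_eq0.
have : l \in s2 by rewrite mem_enum.
move=> ls2; rewrite (@ae_iint_cat R r.+1 s1 s2); move: ls2.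
have : {in s2, forall j, j \in J} by move=> j; rewrite mem_enum.
have := enum_uniq (mem J).
case/lastP : (enum J) => // s l'; rewrite rcons_uniq => /andP[ls _] sJ _.
apply: ae_iintT => y; rewrite -cats1 (@ae_iint_cat R r.+1 s [:: l']).
apply: ae_iintT => z /=.
have l'J : l' \in J by apply: sJ; rewrite mem_rcons mem_head.
(* Once the other coordinates are fixed, a single value of the innermost one gives lambda_1(s) =
   1. *)
apply: (filterS (F := almost_everywhere (@lebesgue_measure R)))
  (ae_neq ((1 - \sum_(j in J | j != l') m j * z j) / m l')) => t ht h.
apply: ht; rewrite -h /lam1_J (bigD1 l')//= {1}/upd eqxx.
rewrite [X in _ + X - _](_ : _ = \sum_(j in J | j != l') m j * z j).
  by rewrite addrK mulrC mulKf// gt_eqF.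
by apply: eq_bigr => j /andP[_ /negbTE jl]; rewrite /upd jl.
Qed.

Lemma L_integrand_upd (y : V) i t : i \in J -> Aint (upd y i t) = Aint y.
Proof.
rewrite in_J => /andP[ij0 iI].
have eI j : j \in I -> upd y i t j = y j.
  by rewrite /upd; case: eqP => // -> jI; rewrite jI in iI.
have es : sec lam chi (upd y i t) = sec lam chi y.
  apply/funext => j; rewrite /sec; case: ifPn => [jI|_]; first exact: eI.
  case: ifP => // _; congr ((_ - _) / _).
    by rewrite /upd eq_sym (negbTE ij0).
  by apply: eq_bigr => l lI; rewrite eI.
rewrite /L_integrand es.
have -> // : [forall j in I, 0 <= upd y i t j] = [forall j in I, 0 <= y j].
by apply: eq_forallb => j; case: (boolP (j \in I)) => //= jI; rewrite eI.
Qed.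

(** The first factor does not see the J coordinates and leaves the inner integral, which is then a
    constant and leaves the outer one. *)
Lemma iint_AB :
  iint (s1 ++ s2) (fun x : V => (Aint x * Bint x)%:E) (fun=> 0) =
  (simplex_vol lam chi * L_chi w lam chi f)%E.
Proof.
rewrite iint_cat L_chiE.
have sf := simplex_vol_fin chi hm.
have s0 : (0 <= simplex_vol lam chi)%E by exact: (mge0_iint s2 (mge0_simplex_indic lam chi)).2.
rewrite -(fineK sf) -(iintM (c := fun=> fine (simplex_vol lam chi)))//; last 2 first.
- exact: mge0_L_integrand.
- by move=> _; exact: fine_ge0.
congr (iint _ _ _); apply/funext => x.
under [X in iint _ X]eq_fun do rewrite EFinM.
rewrite iintM; last 3 first.
- exact: mge0_simplex_indic.
- exact: L_integrand_ge0.
- by move=> i y t; rewrite mem_enum; exact: L_integrand_upd.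
by rewrite iint_simplex_indic fineK// muleC.
Qed.

Lemma asymptotics_ge0 :
  (fun T : R => (((T `^ a * (ln T) ^+ (b_chi lam chi).-1)^-1)%:E
                   * lhs_integral w lam chi f T)%E)
     @ +oo --> (kappa_chi lam chi * L_chi w lam chi f)%E.
Proof.
have [M [U [hM hU]]] := Cc_bounds.
(* Starting at e makes tau = ln T at least 1, as the majorant requires. *)
apply: (@cvg_pinfty_seq _ _ _ _ (expR 1)) => u u1 uoo.
have e1 : 1 < expR 1 :> R by rewrite -[X in X < _]expR0 ltr_expR.
have u1' d : 1 < u d := lt_le_trans e1 (u1 d).
rewrite (_ : (fun d => _) = (fun d => ((m j0)^-1)%:E *
   iint (s1 ++ s2) (fun x => (Hint (ln (u d)) x)%:E) (fun=> 0%R))%E); last first.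
  by apply/funext => d; rewrite lhs_integral_rescaled_integrand.
rewrite kappa_chiE// -muleA -iint_AB; apply: cvgeZl => //.
have tau1 d : 1 <= ln (u d).
  by rewrite -[X in X <= _]expRK ler_ln// posrE ?expR_gt0// (lt_trans ltr01).
have tauoo : ln (u d) @[d --> \oo] --> +oo.
  apply/cvgryPge => A; move/cvgryPge : uoo => /(_ (expR A)); apply: filterS => d hd.
  by rewrite -[X in X <= _]expRK ler_ln// posrE ?expR_gt0// (lt_trans ltr01).
have [| |j|mh fh] := @hfun_fin _ _ n _ lam chi hm hachi f f0 M U hM
  (fun j => indic_seg ((1 + `|U|) / m j)) (s1 ++ s2).
- by move=> j t; exact: indic_seg_ge0.
- by move=> j; exact: measurable_indic_seg.
- by move=> _ _; rewrite integral_indic_seg ?ltry// divr_ge0 ?addr_ge0// ltW.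
apply: (iint_dct us _ _ mh _ fh (ae_generic _)).
- by move=> d; exact: mge0_rescaled_integrand.
- apply: mge0_EFin => [|x]; last by rewrite mulr_ge0 ?L_integrand_ge0 ?simplex_indic_ge0.
  by apply: measurable_funM; [exact: measurable_L_integrand|exact: measurable_simplex_indic].
- by move=> d y; rewrite lee_fin; exact: rescaled_integrand_le.
- move=> y [yJ ys]; apply: cvg_EFin; first exact: nearW.
  exact: rescaled_integrand_cvg.
Qed.

End Nonnegative.

(** * From nonnegative to signed functions *)

Lemma funrposnegB (R : realType) (X : Type) (f : X -> R) v :
  f v = Num.max (f v) 0 - Num.max (- f v) 0.
Proof. by have [h|h] := leP (f v) 0; have [h'|h'] := leP (- f v) 0; lra. Qed.

Theorem theorem6p1 (R : realType) (r n k : nat)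
  (w : 'I_k.+1 -> 'rV[R]_n) (lam : 'I_k.+1 -> 'I_r.+1 -> R)
  (hw : lin_indep w)
  (hm : forall j, 0 < mcoef lam j)
  (hmi : forall i j, 0 <= mcoef_i lam i j)
  (chi : 'I_r.+1 -> R)
  (hachi : 0 < a_chi lam chi)
  (f : 'rV[R]_n -> R) (hf : Cc f) :
  ((fun T : R => (((T `^ a_chi lam chi * (ln T) ^+ (b_chi lam chi).-1)^-1)%:E
                   * lhs_integral w lam chi f T)%E)
     @ +oo --> (kappa_chi lam chi * L_chi w lam chi f)%E)
  /\ (kappa_chi lam chi * L_chi w lam chi f)%E \is a fin_num.
Proof.
pose fp v := Num.max (f v) 0; pose fm v := Num.max (- f v) 0.
have hp : Cc fp by exact: Cc_funrpos.
have hn : Cc fm by exact/Cc_funrpos/Cc_opp.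
have p0 v : 0 <= fp v by rewrite le_max lexx orbT.
have n0 v : 0 <= fm v by rewrite le_max lexx orbT.
have fE v : f v = fp v - fm v by exact: funrposnegB.
have Lp := L_chi_fin hw hm hmi hachi hp p0.
have Ln := L_chi_fin hw hm hmi hachi hn n0.
have kf : kappa_chi lam chi \is a fin_num.
  by rewrite kappa_chiE// fin_numM// simplex_vol_fin.
have LE : L_chi w lam chi f = (L_chi w lam chi fp - L_chi w lam chi fm)%E.
  rewrite [in RHS]L_chiE [X in (_ - X)%E]L_chiE -iintB ?enum_uniq//.
  - rewrite L_chiE; congr (iint _ _ _); apply/funext => x; rewrite -EFinB; congr EFin.
    by rewrite /L_integrand; case: ifP => _; rewrite ?subr0// -mulrBl fE.
  - exact: mge0_L_integrand.
  - exact: mge0_L_integrand.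
  - exact: iint_fin_L_integrand.
  - exact: iint_fin_L_integrand.
have lhsE T : 0 < T -> lhs_integral w lam chi f T =
    (lhs_integral w lam chi fp T - lhs_integral w lam chi fm T)%E.
  move=> T0; rewrite [in RHS]lhs_integralE [X in (_ - X)%E]lhs_integralE -iintB ?enum_uniq//.
  - rewrite lhs_integralE; congr (iint _ _ _); apply/funext => x; rewrite -EFinB; congr EFin.
    by rewrite /lhs_integrand; case: ifP => _; rewrite ?subr0// -mulrBl fE.
  - exact: mge0_lhs_integrand.
  - exact: mge0_lhs_integrand.
  - exact: iint_fin_lhs_integrand.
  - exact: iint_fin_lhs_integrand.
have lf g T : Cc g -> (forall v, 0 <= g v) -> 0 < T -> lhs_integral w lam chi g T \is a fin_num.
  move=> hg g0 T0.
  rewrite lhs_integralE ge0_fin_numE; last first.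
    exact: (mge0_iint _ (mge0_lhs_integrand w lam chi hg g0 T)).2.
  have fG : iint_fin (enum 'I_r.+1) (fun x => (lhs_integrand w lam chi g T x)%:E).
    exact: iint_fin_lhs_integrand.
  by apply: fG => //; exact: enum_uniq.
split; last by rewrite LE fin_numM// fin_numB Lp Ln.
(* In the extended reals, products distribute over this difference and the limits subtract because
   both integrals are finite. *)
rewrite LE muleBr//; last by rewrite fin_num_adde_defl// fin_numN.
apply: cvg_trans; last first.
  apply: cvgeB (asymptotics_ge0 hw hm hmi hachi hp p0) (asymptotics_ge0 hw hm hmi hachi hn n0).
  by rewrite fin_num_adde_defl// fin_numN fin_numM.
apply: near_eq_cvg; near=> T.
have T0 : 0 < T by near: T; exact: nbhs_pinfty_gt.
rewrite lhsE// muleBr// fin_num_adde_defl// fin_numN lf//.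
Unshelve. all: by end_near. Qed.
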